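(* For every integer $q\ge 1$, the Scarf complex $\mathbb{S}^3_q$ of $\mathcal{E}_q^{\,3}$ supports a minimal free resolution of $\mathcal{E}_q^{\,3}$.
   Context: Let $\mathsf{k}$ be a field and $[q]=\{1,\dots,q\}$. For $q\ge1$, the $q$-extremal ideal $\mathcal{E}_q$ is the ideal of the polynomial ring $\mathcal{S}_q=\mathsf{k}[x_A : \emptyset\ne A\subseteq[q]]$ generated by the monomials $\epsilon_i=\prod_{A\subseteq [q],\, i\in A} x_A$, $i\in[q]$; $\mathcal{E}_q^{\,r}$ is its $r$-th power. It is minimally generated by the monomials $\epsilon^{\mathbf a}=\epsilon_1^{a_1}\cdots\epsilon_q^{a_q}$, where $\mathbf a$ runs over $\mathcal{N}^r_q=\{\mathbf a\in\mathbb{N}^q : a_1+\cdots+a_q=r\}$. For a monomial ideal $I$ with minimal monomial generators $m_1,\dots,m_t$, the Taylor complex $\mathbb{T}(I)$ is the full simplex on the generators, each face $\sigma$ being labeled by the monomial $\mathbf{m}_\sigma=\mathrm{lcm}(m_i : m_i\in\sigma)$. The Scarf complex of $I$ is the subcomplex of all faces $\sigma$ of $\mathbb{T}(I)$ such that $\mathbf{m}_\sigma\neq\mathbf{m}_\tau$ for all faces $\tau\ne\sigma$ of $\mathbb{T}(I)$. $\mathbb{S}^r_q$ denotes the Scarf complex of $\mathcal{E}_q^{\,r}$. A subcomplex $\Delta$ of $\mathbb{T}(I)$ supports a (minimal) free resolution of $I$ if the homogenized simplicial chain complex of $\Delta$ (with $F_i$ the free module on the $i$-faces of $\Delta$, differential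 $\partial(\sigma)=\sum_{v\in\sigma}\pm\frac{\mathbf{m}_\sigma}{\mathbf{m}_{\sigma\setminus\{v\}}}\,(\sigma\setminus\{v\})$ with the usual simplicial signs, and augmentation $F_0\to I$ sending each vertex to its label) is a (minimal) free resolution of $I$. *)

(* Defs.v *)
From mathcomp Require Import all_boot all_order all_algebra.
From mathcomp Require Import mpoly.

Set Implicit Arguments.
Unset Strict Implicit.
Unset Printing Implicit Defensive.

Import GRing.Theory.
Local Open Scope ring_scope.

Section Ideals.
Variable R : comNzRingType.

Definition ideal_span (S : R -> Prop) (p : R) : Prop :=
  exists2 s : seq (R * R),
    (forall x, x \in s -> S x.2) & p = \sum_(x <- s) x.1 * x.2.

Definition ideal_mul (I J : R -> Prop) : R -> Prop :=
  ideal_span (fun p => exists x y, [/\ I x, J y & p = x * y]).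

Fixpoint ideal_pow (I : R -> Prop) (r : nat) : R -> Prop :=
  if r is r'.+1 then ideal_mul I (ideal_pow I r') else fun=> True.

End Ideals.

(* Simplicial complexes on a finite vertex set V whose vertices are labeled by
   monomials.  When lab enumerates without repetition the minimal monomial
   generators of an ideal I, the full simplex {set V} is the Taylor complex
   of I. *)
Section LabeledComplex.
Variables (k : fieldType) (n : nat) (V : finType) (lab : V -> 'X_{1..n}).
Local Notation S := {mpoly k[n]}.

Definition face_label (s : {set V}) : 'X_{1..n} :=
  \big[@mlcm n/0%MM]_(v in s) lab v.

Definition scarf : {set {set V}} :=
  [set s | [forall t : {set V}, (t != s) ==> (face_label t != face_label s)]].

(* D is meant to be closed under taking subsets, as scarf is (scarf_closed);
   the empty face plays no role below. *)
Variable D : {set {set V}}.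

(* The i-dimensional faces are those with i + 1 vertices. *)
Definition face (i : nat) : predArgType :=
  {s : {set V} | (s \in D) && (#|s| == i.+1)}.

(* The free S-module on the i-faces. *)
Definition chain (i : nat) : Type := {ffun face i -> S}.

(* The usual simplicial sign (-1)^j, for v the j-th vertex of s (counting from
   0) in the fixed total order of the vertices given by enum V. *)
Definition face_sign (s : {set V}) (v : V) : S :=
  (-1) ^+ #|[set w in s | enum_rank w < enum_rank v]%N|.

Definition differential (i : nat) (c : chain i.+1) : chain i :=
  [ffun t : face i =>
     \sum_(s : face i.+1) \sum_(v in val s | val s :\ v == val t)
        c s * (face_sign (val s) v
               * 'X_[(face_label (val s) - face_label (val s :\ v))%MM])].

(* The augmentation F_0 -> S; a 0-face {v} has label lab v. *)
Definition augmentation (c : chain 0) : S :=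
  \sum_(s : face 0) c s * 'X_[face_label (val s)].

Definition supports_free_resolution (I : S -> Prop) : Prop :=
  [/\ forall p : S, I p <-> exists c : chain 0, augmentation c = p,
      forall c : chain 0,
        augmentation c = 0 <-> exists b : chain 1, differential b = c
    & forall (i : nat) (c : chain i.+1),
        differential c = 0 <-> exists b : chain i.+2, differential b = c].

Definition irrelevant_ideal : S -> Prop :=
  ideal_span (fun p => exists j : 'I_n, p = 'X_j).

(* Every differential F_{i+1} -> F_i has its image in m F_i, where m is the
   ideal generated by the variables. *)
Definition supports_minimal_free_resolution (I : S -> Prop) : Prop :=
  supports_free_resolution I /\
  forall (i : nat) (c : chain i.+1) (t : face i),
    irrelevant_ideal (differential c t).

End LabeledComplex.

Section MonomialIdeal.
Variables (k : fieldType) (n : nat).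

Definition min_monomial_gen (I : {mpoly k[n]} -> Prop) (m : 'X_{1..n}) : Prop :=
  I 'X_[m] /\ forall m' : 'X_{1..n}, I 'X_[m'] -> (m' <= m)%MM -> m' = m.

End MonomialIdeal.

Definition nonempty_subset (q : nat) : predArgType :=
  {A : {set 'I_q} | A != set0}.

(* The variable x_A of S_q is the one of index enum_rank A; [q] is 'I_q. *)
Definition nvars (q : nat) : nat := #|{: nonempty_subset q}|.

Definition epsilon (q : nat) (i : 'I_q) : 'X_{1..nvars q} :=
  (\sum_(A : nonempty_subset q | i \in val A) U_(enum_rank A))%MM.

Definition extremal_ideal (k : fieldType) (q : nat) :
    {mpoly k[nvars q]} -> Prop :=
  ideal_span (fun p => exists i : 'I_q, p = 'X_[epsilon i]).

Definition epsilon_pow (q : nat) (a : 'X_{1..q}) : 'X_{1..nvars q} :=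
  (\sum_(i < q) epsilon i *+ a i)%MM.

(* The set N_q^r of exponent vectors of degree r; the bound in the underlying
   type only serves to make it finite. *)
Definition exponents (q r : nat) : predArgType :=
  {a : 'X_{1..q < r.+1} | mdeg a == r}.

Definition extremal_label (q r : nat) (a : exponents q r) : 'X_{1..nvars q} :=
  epsilon_pow (val (val a)).

Definition extremal_scarf (q r : nat) : {set {set exponents q r}} :=
  scarf (@extremal_label q r).

(* Consistency checks: the Scarf complex is a simplicial complex, and the
   labels extremal_label enumerate without repetition the minimal monomial generators of the
   r-th power of the extremal ideal. *)

Lemma face_label_le (n : nat) (V : finType) (lab : V -> 'X_{1..n})
    (s : {set V}) (m : 'X_{1..n}) :
  (face_label lab s <= m)%MM = [forall v in s, (lab v <= m)%MM].
Proof.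
rewrite /face_label.
transitivity (\big[andb/true]_(v in s) (lab v <= m)%MM); last by rewrite big_andE.
elim/big_rec2: _ => [|v b l _ <-]; last by rewrite lem_mlcm.
by apply/mnm_lepP=> j; rewrite mnm0E.
Qed.

Lemma mnm_le_anti (n : nat) (m1 m2 : 'X_{1..n}) :
  (m1 <= m2)%MM -> (m2 <= m1)%MM -> m1 = m2.
Proof.
move=> /mnm_lepP h1 /mnm_lepP h2; apply/mnmP=> i.
by apply/eqP; rewrite eqn_leq h1 h2.
Qed.

Lemma lab_le_face_label (n : nat) (V : finType) (lab : V -> 'X_{1..n})
    (s : {set V}) (v : V) : v \in s -> (lab v <= face_label lab s)%MM.
Proof.
move=> vs; have := lepm_refl (face_label lab s).
by rewrite face_label_le => /forall_inP; apply.
Qed.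

Lemma scarf_closed (n : nat) (V : finType) (lab : V -> 'X_{1..n})
    (s t : {set V}) : s \in scarf lab -> t \subset s -> t \in scarf lab.
Proof.
rewrite !inE => /forall_inP hs ts; apply/forall_inP=> u.
apply: contra => /eqP lu; apply/eqP.
have lut : forall v, v \in u -> (lab v <= face_label lab t)%MM.
  by move=> v vu; rewrite -lu; apply: lab_le_face_label.
have ltu : forall v, v \in t -> (lab v <= face_label lab u)%MM.
  by move=> v vt; rewrite lu; apply: lab_le_face_label.
have lts : (face_label lab t <= face_label lab s)%MM.
  rewrite face_label_le; apply/forall_inP=> v vt.
  exact/lab_le_face_label/(subsetP ts).
have eq_s (w : {set V}) : face_label lab w = face_label lab s -> w = s.
  by move=> e; apply/eqP; apply: contraT => /hs; rewrite e eqxx.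
have us : u \subset s.
  have <- : u :|: s = s; last exact: subsetUl.
  apply: eq_s; apply: mnm_le_anti; rewrite face_label_le; apply/forall_inP=> v.
    rewrite inE => /orP [/lut h|]; last exact: lab_le_face_label.
    exact: lepm_trans h lts.
  by move=> vs; apply: lab_le_face_label; rewrite inE vs orbT.
have half (a b : {set V}) : a \subset s ->
    (forall v, v \in b -> (lab v <= face_label lab a)%MM) -> b \subset s -> b \subset a.
  move=> as_ hab bs; apply/subsetP=> v vb; apply: contraT => va.
  have e : s :\: (b :\: a) = s.
    apply: eq_s; apply: mnm_le_anti; rewrite face_label_le; apply/forall_inP=> x.
      by rewrite inE => /andP [_ xs]; apply: lab_le_face_label.
    move=> xs; case: (boolP (x \in b :\: a)) => xba; last first.
      by apply: lab_le_face_label; rewrite inE xba.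
    have /setDP [xb _] := xba; apply: lepm_trans (hab x xb) _.
    rewrite face_label_le; apply/forall_inP=> y ya; apply: lab_le_face_label.
    by rewrite !inE ya (subsetP as_).
  have : v \in s by apply: (subsetP bs).
  by rewrite -e !inE vb va.
by apply/eqP; rewrite eqEsubset (half t u) // (half u t).
Qed.

Lemma ideal_span_in (R : comNzRingType) (S : R -> Prop) (p : R) :
  S p -> ideal_span S p.
Proof.
move=> Sp; exists [:: (1, p)]; last by rewrite big_seq1 mul1r.
by move=> x; rewrite inE => /eqP ->.
Qed.

Lemma ideal_spanM (R : comNzRingType) (S : R -> Prop) (p q : R) :
  ideal_span S p -> ideal_span S (q * p).
Proof.
case=> s hs ->; exists [seq (q * x.1, x.2) | x <- s].
  by move=> x /mapP [y /hs hy ->].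
by rewrite big_map mulr_sumr; apply: eq_bigr => x _; rewrite mulrA.
Qed.

Lemma epsilonE (q : nat) (i : 'I_q) (A : nonempty_subset q) :
  epsilon i (enum_rank A) = (i \in val A) :> nat.
Proof.
rewrite /epsilon mnm_sumE.
rewrite (eq_bigr (fun B => (B == A) : nat)); last first.
  by move=> B _; rewrite mnm1E (inj_eq enum_rank_inj).
case: (boolP (i \in val A)) => iA.
  by rewrite (bigD1 A) //= eqxx big1 // => B /andP [_ /negbTE ->].
by rewrite big1 // => B; case: eqP => // ->; rewrite (negbTE iA).
Qed.

Lemma epsilon_powD (q : nat) (a b : 'X_{1..q}) :
  epsilon_pow (a + b) = (epsilon_pow a + epsilon_pow b)%MM.
Proof.
apply/mnmP=> j; rewrite mnmDE /epsilon_pow !mnm_sumE -big_split /=.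
apply: eq_bigr => i _.
by rewrite !mulmnE mnmDE mulnDr.
Qed.

Lemma epsilon_powU (q : nat) (i : 'I_q) : epsilon_pow U_(i)%MM = epsilon i.
Proof.
apply/mnmP=> j; rewrite /epsilon_pow mnm_sumE (bigD1 i) //= big1 => [|l li].
  by rewrite addn0 mulmnE mnm1E eqxx muln1.
by rewrite mulmnE mnm1E eq_sym (negbTE li) muln0.
Qed.

(* The exponent of x_{ {i} } in epsilon^a is a_i. *)
Lemma epsilon_pow_set1 (q : nat) (a : 'X_{1..q}) (i : 'I_q)
    (A : nonempty_subset q) :
  val A = [set i] -> epsilon_pow a (enum_rank A) = a i.
Proof.
move=> eA; rewrite /epsilon_pow mnm_sumE (bigD1 i) //= big1 => [|l li].
  by rewrite addn0 mulmnE epsilonE eA set11 mul1n.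
by rewrite mulmnE epsilonE eA inE (negbTE li).
Qed.

Lemma epsilon_pow_le (q : nat) (a b : 'X_{1..q}) :
  (epsilon_pow a <= epsilon_pow b)%MM -> (a <= b)%MM.
Proof.
move=> /mnm_lepP h; apply/mnm_lepP=> i.
have i0 : [set i] != set0 by apply/set0Pn; exists i; rewrite set11.
have := h (enum_rank (Sub [set i] i0 : nonempty_subset q)).
by rewrite !(@epsilon_pow_set1 _ _ i).
Qed.

Lemma mnm_le_deg_eq (n : nat) (a b : 'X_{1..n}) :
  (a <= b)%MM -> mdeg a = mdeg b -> a = b.
Proof.
move=> ab e; have := submK ab => eb.
have : mdeg (b - a)%MM = 0%N.
  by apply/eqP; rewrite -(eqn_add2r (mdeg a)) -mdegD eb e.
by move/eqP; rewrite mdeg_eq0 => /eqP z; rewrite -eb z add0m.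
Qed.

Section ExtremalPower.
Variables (k : fieldType) (q : nat).
Local Notation S := {mpoly k[nvars q]}.

Lemma extremal_pow_mem (r : nat) (a : 'X_{1..q}) :
  mdeg a = r -> ideal_pow (@extremal_ideal k q) r 'X_[epsilon_pow a].
Proof.
elim: r a => [//|r IH] a da /=.
have [i ai] : exists i, a i != 0%N.
  apply/existsP; apply: contraT; rewrite negb_exists => /forallP h.
  have : mdeg a = 0%N by rewrite mdegE big1 // => i _; apply/eqP; have := h i; rewrite negbK.
  by rewrite da.
have ea : a = (U_(i) + (a - U_(i)))%MM.
  rewrite addmC submK //; apply/mnm_lepP=> j; rewrite mnm1E.
  by case: eqP => // <-; rewrite lt0n.
apply: ideal_span_in; exists 'X_[epsilon i], 'X_[epsilon_pow (a - U_(i))%MM].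
split; last by rewrite {1}ea epsilon_powD epsilon_powU mpolyXD.
  by apply: ideal_span_in; exists i.
by apply: IH; apply/eqP; rewrite -(eqn_add2l 1%N) -{1}(mdeg1 i) -mdegD -ea da.
Qed.

Lemma msupp_sum_mul (s : seq (S * S)) (m : 'X_{1..nvars q}) :
  m \in msupp (\sum_(x <- s) x.1 * x.2) ->
  exists2 x, x \in s & exists2 m', m' \in msupp x.2 & (m' <= m)%MM.
Proof.
elim: s => [|x s IH]; first by rewrite big_nil msupp0.
rewrite big_cons => /msuppD_le; rewrite mem_cat => /orP [] h.
  have /allpairsP [[u v] /= [_ hv ->]] := msuppM_le h.
  exists x; first by rewrite mem_head.
  by exists v => //; exact: lem_addl.
have [y ys hy] := IH h.
by exists y => //; rewrite inE ys orbT.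
Qed.

Lemma extremal_pow_msupp (r : nat) (p : S) (m : 'X_{1..nvars q}) :
  ideal_pow (@extremal_ideal k q) r p -> m \in msupp p ->
  exists2 a : 'X_{1..q}, mdeg a = r & (epsilon_pow a <= m)%MM.
Proof.
elim: r p m => [|r IH] p m /=.
  move=> _ _; exists 0%MM; first exact: mdeg0.
  apply/mnm_lepP=> j; rewrite /epsilon_pow mnm_sumE big1 // => i _.
  by rewrite mulmnE mnm0E muln0.
case=> s hs -> /msupp_sum_mul [x /hs [y [z [hy hz ->]]] [m' hm' m'm]].
have /allpairsP [[u v] /= [hu hv em']] := msuppM_le hm'.
case: hy => s' hs' ey; move: hu; rewrite ey.
move=> /msupp_sum_mul [x' /hs' [i ->] [w]].
rewrite msuppX inE => /eqP -> iu.
have [a da av] := IH _ _ hz hv.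
exists (U_(i) + a)%MM; first by rewrite mdegD mdeg1 da.
rewrite epsilon_powD epsilon_powU; apply: lepm_trans m'm.
rewrite em'; apply/mnm_lepP=> j; rewrite !mnmDE.
by apply: leq_add; [move/mnm_lepP: iu | move/mnm_lepP: av].
Qed.

Lemma extremal_label_min_gens (r : nat) :
  injective (@extremal_label q r) /\
  forall m : 'X_{1..nvars q},
    min_monomial_gen (ideal_pow (@extremal_ideal k q) r) m <->
    exists a : exponents q r, extremal_label a = m.
Proof.
split=> [a b /= eab|m].
  do 2!apply: val_inj; apply: mnm_le_anti; apply: epsilon_pow_le;
  by move: eab; rewrite /extremal_label => ->; exact: lepm_refl.
split=> [[mI mmin]|[a <-]].
  have [|a da am] := extremal_pow_msupp mI (m := m).
    by rewrite msuppX mem_head.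
  have ha : (mdeg a < r.+1)%N by rewrite da.
  have ha' : mdeg (BMultinom ha) == r by apply/eqP.
  exists (Sub (BMultinom ha) ha'); rewrite /extremal_label /=.
  by apply: mmin am; apply: extremal_pow_mem.
have da := eqP (valP a); split; first exact: extremal_pow_mem.
move=> m' m'I m'a.
have [|b db bm'] := extremal_pow_msupp m'I (m := m').
  by rewrite msuppX mem_head.
have ba : b = val (val a).
  by apply: mnm_le_deg_eq; rewrite ?db ?da //; apply/epsilon_pow_le/(lepm_trans bm').
by apply: mnm_le_anti => //; rewrite /extremal_label -ba.
Qed.

End ExtremalPower.

(* Main.v *)
Require Import Defs.
From mathcomp Require Import all_boot all_order all_algebra.
From mathcomp Require Import mpoly zify.

Set Implicit Arguments.
Unset Strict Implicit.
Unset Printing Implicit Defensive.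

Import GRing.Theory.

(* Fix a label m of the Taylor complex of E_q^r, let W be the set of generators
   dividing it and, for A a subset of [q], let W_A be the set of those a in W
   whose exponent a(A) at x_A is the exponent m(A) of m.  The faces labeled m are
   the subsets of W that meet every W_A.  If every a in W is isolated, i.e. forms
   a singleton W_B, then W is the only face labeled m, and it is a Scarf face.
   If some v in W is redundant, i.e. every W_A containing v contains some W_B not
   containing v, then adding v to a face or removing it from a face never changes
   the label m.  For r <= 3 one of the two always happens.

   In the second case the faces labeled m cancel in pairs {t, t + v}.  A Scarf
   cycle of multidegree M bounds in the full simplex on the generators dividing
   x^M; pushing the bounding chain along these pairs, from the labels of largest
   degree downwards, makes it a chain of Scarf faces. *)

(** * Labels of degree three *)

Section Triples.
Variables (q : nat) (m : {set 'I_q} -> nat).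
Implicit Types (A B : {set 'I_q}) (i j k l x y z : 'I_q).

(* The indices i, j, k, in any order, encode the generator epsilon_i epsilon_j epsilon_k,
   whose exponent at x_A is [count3 A i j k]. *)
Definition count3 A i j k : nat := (i \in A) + (j \in A) + (k \in A).

Definition bounded3 i j k : bool := [forall A, count3 A i j k <= m A].

(** Letting [p] range over all functions expresses equality of the multisets [x, y, z] and
    [i, j, k]; point indicators recover the multiplicities, and [fun t => t \in A] the counts at
    [A]. *)
Definition isolated3 i j k : Prop :=
  exists B, forall x y z, bounded3 x y z -> count3 B x y z = m B ->
    forall p : 'I_q -> nat, p x + p y + p z = p i + p j + p k.

Definition redundant3 i j k : Prop :=
  bounded3 i j k /\
  forall A, count3 A i j k = m A ->
    exists2 B, count3 B i j k < m B &
      forall x y z, bounded3 x y z -> count3 B x y z = m B -> count3 A x y z = m A.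

Lemma bounded3_le i j k A : bounded3 i j k -> (i \in A) + (j \in A) + (k \in A) <= m A.
Proof. by move/forallP/(_ A). Qed.

Lemma bounded3_swap12 i j k : bounded3 i j k -> bounded3 j i k.
Proof. by move/forallP=> h; apply/forallP=> A; have := h A; rewrite /count3; lia. Qed.

Lemma bounded3_swap23 i j k : bounded3 i j k -> bounded3 i k j.
Proof. by move/forallP=> h; apply/forallP=> A; have := h A; rewrite /count3; lia. Qed.

(** Counts are at most 3, so a bound above 2 is attained only inside [B]. This computes [W_B] when
    [B] is the support of a generator dividing the label. *)
Lemma count3_full B x y z :
  count3 B x y z = m B -> 2 < m B -> [/\ x \in B, y \in B & z \in B].
Proof. by rewrite /count3 => <-; do 3!case: (_ \in B). Qed.

(** Evaluates membership in explicit sets, abstracts the values of [m], splits on the remaining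
    memberships and leaves linear arithmetic. *)
Ltac solve_counts :=
  rewrite ?/count3 ?inE ?eqxx;
  repeat match goal with h : is_true (?a != ?b) |- _ =>
    rewrite ?(negbTE h); rewrite eq_sym in h; rewrite ?(negbTE h); clear h end;
  rewrite ?orbT ?orbF /=; clear;
  repeat match goal with |- context [?f ?B] =>
    lazymatch type of (f B) with nat => 
    lazymatch type of B with {set _} => generalize (f B) end end end;
  repeat match goal with
    | |- context [?a \in ?A] => case: (a \in A)
    | |- context [?a == ?b] => case: (a == b) end;
  rewrite /=; lia.

Ltac bound A :=
  repeat match goal with h : is_true (bounded3 _ _ _) |- _ =>
    have {h} := @bounded3_le _ _ _ A h end.

Lemma bounded3_distinct (D : {pred 'I_q}) x y z :
  {in D &, forall j k, ~~ bounded3 j j k} ->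
  bounded3 x y z -> x \in D -> y \in D -> z \in D -> [/\ x != y, y != z & x != z].
Proof.
move=> D2 w xD yD zD; split; apply/eqP=> e; subst.
- by move: (D2 _ _ yD zD); rewrite w.
- by move: (D2 _ _ zD xD); rewrite bounded3_swap12 // bounded3_swap23 // bounded3_swap12.
- by move: (D2 _ _ zD yD); rewrite bounded3_swap23.
Qed.

Lemma isolated3_perm i j k i' j' k' :
  (forall p : 'I_q -> nat, p i + p j + p k = p i' + p j' + p k') ->
  isolated3 i j k -> isolated3 i' j' k'.
Proof. by move=> e [B h]; exists B => x y z w c p; rewrite -e; apply: h. Qed.

Lemma count3_set1 i x y z : bounded3 x y z -> 1 < count3 [set i] x y z ->
  exists2 t, bounded3 i i t & forall p : 'I_q -> nat, p x + p y + p z = p i + p i + p t.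
Proof.
rewrite /count3 !inE.
case: (eqVneq x i) => [->|_]; case: (eqVneq y i) => [->|_]; case: (eqVneq z i) => [->|_] // w _.
- by exists i.
- by exists z.
- by exists y => [|p]; [apply: bounded3_swap23 | lia].
- by exists x => [|p]; [apply/bounded3_swap23/bounded3_swap12 | lia].
Qed.

Lemma count3_ge2 B x y z : bounded3 x y z -> 1 < count3 B x y z ->
  exists u v t, [/\ bounded3 u v t, u \in B, v \in B &
    forall p : 'I_q -> nat, p x + p y + p z = p u + p v + p t].
Proof.
rewrite /count3.
case: (boolP (x \in B)) => xB; case: (boolP (y \in B)) => yB; case: (boolP (z \in B)) => zB // w _.
- by exists x, y, z.
- by exists x, y, z.
- by exists x, z, y; split=> // [|p]; [apply: bounded3_swap23 | lia].
- by exists y, z, x; split=> // [|p]; [apply/bounded3_swap23/bounded3_swap12 | lia].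
Qed.

Lemma count3_set2 i j x y z : (forall t, ~~ bounded3 t t t) ->
  bounded3 x y z -> x \in [set i; j] -> y \in [set i; j] -> z \in [set i; j] ->
  (bounded3 i i j /\ forall p : 'I_q -> nat, p x + p y + p z = p i + p i + p j) \/
  (bounded3 j j i /\ forall p : 'I_q -> nat, p x + p y + p z = p j + p j + p i).
Proof.
move=> no3 w; rewrite !inE.
case/orP=> /eqP ?; case/orP=> /eqP ?; case/orP=> /eqP ?; subst;
  try by move: (no3 i) (no3 j); rewrite w.
- by left.
- by left; split=> [|p]; [apply: bounded3_swap23 | lia].
- by right; split=> [|p]; [apply/bounded3_swap23/bounded3_swap12 | lia].
- by left; split=> [|p]; [apply/bounded3_swap23/bounded3_swap12 | lia].
- by right; split=> [|p]; [apply: bounded3_swap23 | lia].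
- by right.
Qed.

Lemma count3_set3 (D : {pred 'I_q}) i j k x y z :
  {in D &, forall u v, ~~ bounded3 u u v} -> i \in D -> j \in D -> k \in D ->
  bounded3 x y z -> x \in [set i; j; k] -> y \in [set i; j; k] -> z \in [set i; j; k] ->
  forall p : 'I_q -> nat, p x + p y + p z = p i + p j + p k.
Proof.
move=> D2 iD jD kD w.
have sub t : t \in [set i; j; k] -> t \in D by rewrite !inE -!orbA => /or3P [] /eqP->.
move=> xs ys zs p; have [] := bounded3_distinct D2 w (sub _ xs) (sub _ ys) (sub _ zs).
move: xs ys zs; rewrite !inE -!orbA => /or3P [] /eqP-> /or3P [] /eqP-> /or3P [] /eqP->;
by rewrite ?eqxx // => _ _ _; lia.
Qed.

(** No [epsilon_i] divides all generators under [m]; a common factor is split off beforehand by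
    [dichotomy_shift]. *)
Hypothesis avoid : forall i, exists x y z,
  [/\ bounded3 x y z, x != i, y != i & z != i].


(** [W_B] for [B = [set i]] is the cube [iii] alone. If a square [jjk] avoids [i], this one set
    serves every [A] attained by [iij]. Otherwise [iix] is redundant: the cube serves the [A]
    containing [i], and [xyz] the others. *)
Lemma redundant_cube i : bounded3 i i i -> exists x y z, redundant3 x y z.
Proof.
move=> wi.
have [x [y [z [wa xi yi zi]]]] := avoid i.
case: (boolP [exists j, exists k, [&& j != i, k != i & bounded3 j j k]]).
  case/existsP=> j /existsP [k /and3P [ji ki wj]].
  exists i, i, j; split; first by apply/forallP=> A; bound A; solve_counts.
  move=> A h; exists [set i]; first by bound [set i]; solve_counts.
  move=> a b c wabc /count3_full []; first by bound [set i]; solve_counts.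
  by rewrite !inE => /eqP ? /eqP ? /eqP ?; subst; move: h; bound A; solve_counts.
rewrite negb_exists => /forallP no2.
have {}no2 : {in predC1 i &, forall j k, ~~ bounded3 j j k}.
  by move=> j k; rewrite !inE => ji ki; move: (no2 j); rewrite negb_exists => /forallP/(_ k); rewrite ji ki.
exists i, i, x; split; first by apply/forallP=> A; bound A; solve_counts.
move=> A h; case: (boolP (i \in A)) => iA.
  exists [set i]; first by bound [set i]; solve_counts.
  move=> a b c wabc /count3_full []; first by bound [set i]; solve_counts.
  by rewrite !inE => /eqP ? /eqP ? /eqP ?; subst; move: h iA; bound A; solve_counts.
(* As [i] is not in [A], [m A] is the count of [x] alone, which squeezes the count of [xyz] to
   [m A]. *)
exists [set x; y; z]; first by bound [set x; y; z]; solve_counts.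
move=> a b c wabc /count3_full []; first by have := bounded3_le [set x; y; z] wa; solve_counts.
move=> aB bB cB.
have e := count3_set3 no2 xi yi zi wabc aB bB cB (fun t => t \in A).
by move: h iA e; bound A; solve_counts.
Qed.

(** * Redundant generators in the absence of cubes *)

Hypothesis no3 : forall t, ~~ bounded3 t t t.

Lemma square_neq i j : bounded3 i i j -> j != i.
Proof. by move=> w; apply/eqP=> e; move: w; rewrite e (negbTE (no3 i)). Qed.

(** If [A] contains [k] but not both [i] and [j], then [m A <= 2], and every [kkt] under [m] attains
    it. For the other [A], the triples inside [[set i; j]] do. *)
Lemma redundant_disjoint i j k l : i != k -> j != k -> l != i ->
  bounded3 i i j -> bounded3 k k l -> redundant3 i j k.
Proof.
move=> ik jk li wi wk; have ji := square_neq wi; have lk := square_neq wk.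
split; first by apply/forallP=> A; bound A; solve_counts.
move=> A h; case: (boolP ((k \in A) && ~~ ((i \in A) && (j \in A)))) => kA.
  exists [set k]; first by bound [set k]; solve_counts.
  move=> a b c wabc hb; have [|t wt e] := count3_set1 (i := k) wabc.
    by rewrite hb; have := bounded3_le [set k] wk; solve_counts.
  by move: h kA (e (fun t => t \in A)); bound A; solve_counts.
exists [set i; j]; first by bound [set i; j]; solve_counts.
move=> a b c wabc /count3_full []; first by have := bounded3_le [set i; j] wi; solve_counts.
move=> aB bB cB.
have [[_ e]|[_ e]] := count3_set2 no3 wabc aB bB cB;
  by move: h kA (e (fun t => t \in A)); bound A; solve_counts.
Qed.

(** [iik] is alone in [W_B] for [B = [set i]], and [kkl] for [B = [set k; l]] because [llk] is
    excluded. The latter serves the [A] containing [k] but not [i], the former all others. *)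
Lemma redundant_chain i k l : (forall x, bounded3 i i x -> x = k) -> l != i ->
  bounded3 i i k -> bounded3 k k l -> ~~ bounded3 l l k -> redundant3 i k k.
Proof.
move=> Ni li wi wk nl; have ki := square_neq wi; have lk := square_neq wk.
split; first by apply/forallP=> A; bound A; solve_counts.
move=> A h; case: (boolP ((k \in A) && (i \notin A))) => kA.
  exists [set k; l]; first by bound [set k; l]; solve_counts.
  move=> a b c wabc /count3_full []; first by have := bounded3_le [set k; l] wk; solve_counts.
  move=> aB bB cB.
  have [[_ e]|[wl _]] := count3_set2 no3 wabc aB bB cB; last by rewrite wl in nl.
  by move: h kA (e (fun t => t \in A)); bound A; solve_counts.
exists [set i]; first by bound [set i]; solve_counts.
move=> a b c wabc hb; have [|t /Ni-> e] := count3_set1 (i := i) wabc.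
  by rewrite hb; have := bounded3_le [set i] wi; solve_counts.
by move: h kA (e (fun t => t \in A)); bound A; solve_counts.
Qed.

(** The set [B] collects those of [i], [k] that lie in [A]; if neither does, it is [[set x; y; z]],
    which singles out [xyz] because every square under [m] involves [i]. *)
Lemma redundant_mutual i k x y z :
  (forall t, bounded3 i i t -> t = k) -> (forall t, bounded3 k k t -> t = i) ->
  (forall u t, bounded3 u u t -> u = i \/ u = k) ->
  bounded3 i i k -> bounded3 k k i ->
  bounded3 x y z -> x != i -> y != i -> z != i -> x != k -> redundant3 i k x.
Proof.
move=> Ni Nk I2 wi wk wx xi yi zi xk; have ki := square_neq wi.
have no2 : {in predC1 i &, forall u v, ~~ bounded3 u u v}.
  move=> u v; rewrite !inE => ui vi; apply/negP=> w.
  case: (I2 _ _ w) => e; first by rewrite e eqxx in ui.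
  by rewrite e in w; rewrite (Nk _ w) eqxx in vi.
split; first by apply/forallP=> A; bound A; solve_counts.
move=> A h; case: (boolP (i \in A)) => iA; case: (boolP (k \in A)) => kA.
- exists [set i; k]; first by have := bounded3_le [set i; k] wi; solve_counts.
  move=> a b c wabc /count3_full []; first by have := bounded3_le [set i; k] wi; solve_counts.
  move=> aB bB cB.
  have [[_ e]|[_ e]] := count3_set2 no3 wabc aB bB cB;
    by move: h iA kA (e (fun t => t \in A)); bound A; solve_counts.
- exists [set i]; first by have := bounded3_le [set i] wi; solve_counts.
  move=> a b c wabc hb; have [|t /Ni-> e] := count3_set1 (i := i) wabc.
    by rewrite hb; have := bounded3_le [set i] wi; solve_counts.
  by move: h iA kA (e (fun t => t \in A)); bound A; solve_counts.
- exists [set k]; first by have := bounded3_le [set k] wk; solve_counts.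
  move=> a b c wabc hb; have [|t /Nk-> e] := count3_set1 (i := k) wabc.
    by rewrite hb; have := bounded3_le [set k] wk; solve_counts.
  by move: h iA kA (e (fun t => t \in A)); bound A; solve_counts.
have [xy yz xz] := bounded3_distinct no2 wx xi yi zi.
(* [k] may be [y] or [z], but [i] lies outside this set, so [ikx] counts at most 2 there. *)
exists [set x; y; z]; first by move: (bounded3_le [set x; y; z] wx) yz;
  case: (eqVneq y k) => [->|_]; solve_counts.
move=> a b c wabc /count3_full []; first by have := bounded3_le [set x; y; z] wx; solve_counts.
move=> aB bB cB; have e := count3_set3 no2 xi yi zi wabc aB bB cB (fun t => t \in A).
by move: h iA kA e; bound A; solve_counts.
Qed.

(** For [A] containing [i] the squares based at [i] take over: [iij] if [j] is in [A], any [iit] if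
    not. For [A] missing [i], [jkl] takes over, being alone on its support. *)
Lemma redundant_single i j k l : (forall u t, bounded3 u u t -> u = i) ->
  bounded3 i i j -> bounded3 j k l -> j != i -> k != i -> l != i -> redundant3 i j k.
Proof.
move=> I2 wi wj ji ki li.
have no2 : {in predC1 i &, forall u v, ~~ bounded3 u u v}.
  by move=> u v; rewrite !inE => ui _; apply: contraNN ui => /I2 ->.
have [jk kl jl] := bounded3_distinct no2 wj ji ki li.
split; first by apply/forallP=> A; bound A; solve_counts.
move=> A h; case: (boolP (i \in A)) => iA; first case: (boolP (j \in A)) => jA.
- exists [set i; j]; first by have := bounded3_le [set i; j] wi; solve_counts.
  move=> a b c wabc /count3_full []; first by have := bounded3_le [set i; j] wi; solve_counts.
  move=> aB bB cB.
  have [[_ e]|[_ e]] := count3_set2 no3 wabc aB bB cB;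
    by move: h iA jA (e (fun t => t \in A)); bound A; solve_counts.
- exists [set i]; first by have := bounded3_le [set i] wi; solve_counts.
  move=> a b c wabc hb; have [|t _ e] := count3_set1 (i := i) wabc.
    by rewrite hb; have := bounded3_le [set i] wi; solve_counts.
  by move: h iA jA (e (fun t => t \in A)); bound A; solve_counts.
exists [set j; k; l]; first by have := bounded3_le [set j; k; l] wj; solve_counts.
move=> a b c wabc /count3_full []; first by have := bounded3_le [set j; k; l] wj; solve_counts.
move=> aB bB cB; have e := count3_set3 no2 ji ki li wabc aB bB cB (fun t => t \in A).
by move: h iA e; bound A; solve_counts.
Qed.

(** Two squares neither of which ends in the base of the other fall under [redundant_disjoint].
    Without such a pair, either [iik] continues to some [kkl] with [l != i], or [iik] and [kki] are
    the only squares. *)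
Lemma redundant_two_squares i j k l : i != k -> bounded3 i i j -> bounded3 k k l ->
  (forall t, bounded3 i i t -> t = k) -> exists x y z, redundant3 x y z.
Proof.
move=> ik wi wk Ni; have ej := Ni _ wi; rewrite {j}ej in wi.
case: (boolP [exists u, exists v, exists s, exists t,
    [&& bounded3 u u s, bounded3 v v t, u != v, s != v & t != u]]).
  case/existsP=> u /existsP [v /existsP [s /existsP [t /and5P [wu wv uv sv tu]]]].
  by exists u, s, v; apply: redundant_disjoint wu wv.
move=> noD.
have {}noD u v s t : bounded3 u u s -> bounded3 v v t -> u != v -> s = v \/ t = u.
  move=> wu wv uv; case: (eqVneq s v) => [|sv]; first by left.
  case: (eqVneq t u) => [|tu]; first by right.
  case/negP: noD; apply/existsP; exists u; apply/existsP; exists v.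
  by apply/existsP; exists s; apply/existsP; exists t; rewrite wu wv uv sv tu.
case: (boolP [exists l, bounded3 k k l && (l != i)]) => [/existsP [l' /andP [wl l'i]]|Nk].
  exists i, k, k; apply: (redundant_chain Ni l'i wi wl); apply/negP=> wl'.
  have l'k := square_neq wl.
  case: (noD i l' k k wi wl'); first by rewrite eq_sym.
    by move=> e; rewrite e eqxx in l'k.
  by move=> e; rewrite e eqxx in ik.
have {}Nk t : bounded3 k k t -> t = i.
  by move=> w; apply/eqP; apply: contraNT Nk => ti; apply/existsP; exists t; rewrite w.
have el := Nk _ wk; rewrite {l}el in wk.
have I2 u t : bounded3 u u t -> u = i \/ u = k.
  move=> w; case: (eqVneq u i) => [|ui]; first by left.
  case: (eqVneq u k) => [|uk]; first by right.
  case: (noD i u k t wi w) => [|e|e]; first by rewrite eq_sym.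
    by rewrite e eqxx in uk.
  case: (noD k u i t wk w) => [|e'|e']; first by rewrite eq_sym.
    by rewrite e' eqxx in ui.
  by rewrite -e -e' eqxx in ik.
have [x [y [z [w xi yi zi]]]] := avoid i.
(* [redundant_mutual] needs a first entry other than [k]. If [x] is [k], then [y] qualifies, since
   [kkz] would force [z = i]. *)
case: (eqVneq x k) => [ex|xk].
  exists i, k, y; rewrite ex in w; apply: (redundant_mutual (y := k) (z := z) Ni Nk I2) => //.
  - exact: bounded3_swap12.
  - by rewrite eq_sym.
  - by apply: contraNneq zi => e; rewrite e in w; apply/eqP/Nk.
by exists i, k, x; apply: (redundant_mutual Ni Nk I2 wi wk w).
Qed.

(** * Isolated generators in degree three *)

Lemma isolated_distinct i j k : (forall u t, ~~ bounded3 u u t) -> bounded3 i j k ->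
  isolated3 i j k.
Proof.
move=> no2 w; exists [set i; j; k] => x y z wx /count3_full [].
  by have := bounded3_le [set i; j; k] w; solve_counts.
by move=> xB yB zB; apply: (@count3_set3 predT) => // u v _ _; apply: no2.
Qed.

(** Each generator is isolated by its support, except [iuv] when [iiu] is also under [m]: the
    support then contains [iiu] as well, and [[set u; v]] is used instead. *)
Lemma isolated_single i x y z : (forall u t, bounded3 u u t -> u = i) ->
  (forall j k l, bounded3 i i j -> bounded3 j k l -> [|| j == i, k == i | l == i]) ->
  bounded3 x y z -> isolated3 x y z.
Proof.
move=> I2 noT.
have no2 : {in predC1 i &, forall u v, ~~ bounded3 u u v}.
  by move=> u v; rewrite !inE => ui _; apply: contraNN ui => /I2 ->.
have isoS j : bounded3 i i j -> isolated3 i i j.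
  move=> w; have ji := square_neq w.
  exists [set i; j] => a b c wabc /count3_full [].
    by have := bounded3_le [set i; j] w; solve_counts.
  move=> aB bB cB; have [[_ //]|[wj _]] := count3_set2 no3 wabc aB bB cB.
  by rewrite (I2 _ _ wj) eqxx in ji.
have isoN u v : bounded3 i u v -> u != i -> v != i -> bounded3 i i u -> isolated3 i u v.
  move=> w ui vi wu.
  have uv : u != v.
    apply: contraNneq ui => e; rewrite -e in w; apply/eqP; apply: (I2 _ i).
    by apply/bounded3_swap23/bounded3_swap12.
  exists [set u; v] => a b c wabc hb.
  have [|s [t [r [wstr su tu e]]]] := count3_ge2 (B := [set u; v]) wabc.
    by rewrite hb; have := bounded3_le [set u; v] w; solve_counts.
  (* Equal entries would be a square not based at [i]; a third entry other than [i] would give a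
     triple through [u] that avoids [i], contrary to [noT]. *)
  have [st re] : s != t /\ r = i.
    have neq i' : i' \in [set u; v] -> i' != i by rewrite !inE => /orP [] /eqP->.
    have si := neq _ su; have ti := neq _ tu; split.
      by apply: contraNneq si => est; rewrite -est in wstr; apply/eqP/(I2 _ r).
    apply/eqP; move: su tu; rewrite !inE => /orP [] /eqP es /orP [] /eqP et; subst.
    - by rewrite (I2 _ _ wstr) eqxx in ui.
    - by have := noT _ _ _ wu wstr; rewrite (negbTE si) (negbTE ti).
    - by have := noT _ _ _ wu (bounded3_swap12 wstr); rewrite (negbTE si) (negbTE ti).
    - by rewrite (I2 _ _ wstr) eqxx in vi.
  move=> p; rewrite e re; move: su tu st; rewrite !inE => /orP [] /eqP-> /orP [] /eqP->;
  by rewrite ?eqxx // => _; lia.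
have iso u v : bounded3 i u v -> isolated3 i u v.
  move=> w; case: (eqVneq u i) => [eu|ui]; first by rewrite eu in w *; apply: isoS.
  case: (eqVneq v i) => [ev|vi].
    rewrite ev in w *; apply: (isolated3_perm _ (isoS u (bounded3_swap23 w))) => p; lia.
  case: (boolP (bounded3 i i u)) => [|nu]; first exact: isoN.
  case: (boolP (bounded3 i i v)) => [wv|nv].
    by apply: (isolated3_perm _ (isoN v u (bounded3_swap23 w) vi ui wv)) => p; lia.
  have D2 : {in [set i; u; v] &, forall a b, ~~ bounded3 a a b}.
    move=> a b _; rewrite !inE -!orbA => bB; apply/negP=> wab.
    have ea := I2 _ _ wab; rewrite ea in wab; case/or3P: bB => /eqP eb; rewrite eb in wab.
    - by rewrite (negbTE (no3 i)) in wab.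
    - by rewrite wab in nu.
    - by rewrite wab in nv.
  exists [set i; u; v] => a b c wabc /count3_full [].
    by have := bounded3_le [set i; u; v] w; solve_counts.
  by move=> aB bB cB; apply: (count3_set3 D2) => //; rewrite !inE eqxx ?orbT.
move=> w; case: (eqVneq x i) => [ex|xi]; first by rewrite ex in w *; apply: iso.
case: (eqVneq y i) => [ey|yi].
  rewrite ey in w *; apply: (isolated3_perm _ (iso _ _ (bounded3_swap12 w))) => p; lia.
case: (eqVneq z i) => [ez|zi].
  rewrite ez in w *; apply: (isolated3_perm _ (iso _ _ (bounded3_swap12 (bounded3_swap23 w)))) => p; lia.
exists [set x; y; z] => a b c wabc /count3_full [].
  by have := bounded3_le [set x; y; z] w; solve_counts.
by move=> aB bB cB; apply: (count3_set3 no2).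
Qed.

End Triples.

(** A redundant generator arises from a cube, from squares with two different bases, or from a
    square [iij] with a triple [jkl] avoiding [i]. In all other configurations every generator is
    isolated. *)
Lemma dichotomy3 q (m : {set 'I_q} -> nat) :
  (forall i, exists x y z, [/\ bounded3 m x y z, x != i, y != i & z != i]) ->
  (forall i j k, bounded3 m i j k -> isolated3 m i j k) \/
  exists i j k, redundant3 m i j k.
Proof.
move=> avoid.
case: (boolP [exists i, bounded3 m i i i]) => [/existsP [i w]|/existsPn no3].
  by right; apply: redundant_cube w.
case: (boolP [exists i, exists j, bounded3 m i i j]); last first.
  move=> no2; left=> i j k; apply: isolated_distinct => u t.
  by apply: contraNN no2 => w; apply/existsP; exists u; apply/existsP; exists t.
case/existsP=> i /existsP [j wi].
case: (boolP [exists k, exists l, (k != i) && bounded3 m k k l]).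
  case/existsP=> k /existsP [l /andP [ki wk]]; right.
  case: (boolP [exists t, bounded3 m i i t && (t != k)]) => [/existsP [t /andP [wt tk]]|Ni].
    case: (boolP [exists s, bounded3 m k k s && (s != i)]) => [/existsP [s /andP [ws si]]|Nk].
      exists i, t, k; apply: redundant_disjoint wt ws => //; first by rewrite eq_sym.
    apply: (redundant_two_squares avoid no3 ki wk wi) => s ws.
    by apply/eqP; apply: contraNT Nk => si; apply/existsP; exists s; rewrite ws.
  apply: (redundant_two_squares avoid no3 _ wi wk) => [|s ws]; first by rewrite eq_sym.
  by apply/eqP; apply: contraNT Ni => si; apply/existsP; exists s; rewrite ws.
move=> noI.
have {}noI u t : bounded3 m u u t -> u = i.
  move=> w; apply/eqP; apply: contraNT noI => ui.
  by apply/existsP; exists u; apply/existsP; exists t; rewrite ui.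
case: (boolP [exists j, exists k, exists l,
    [&& bounded3 m i i j, bounded3 m j k l, j != i, k != i & l != i]]).
  case/existsP=> s /existsP [k /existsP [l /and5P [ws wsk si ki li]]].
  by right; exists i, s, k; apply: redundant_single wsk si ki li.
move=> noT; left=> x y z; apply: (isolated_single no3 noI) => s k l ws wsk.
apply: contraNT noT; rewrite !negb_or => /and3P [si ki li].
apply/existsP; exists s; apply/existsP; exists k; apply/existsP; exists l.
by rewrite ws wsk si ki li.
Qed.

(** * From degree three to any degree at most three *)

Section Weights.
Variable q : nat.
Implicit Types (A B : {set 'I_q}) (a b v : 'X_{1..q}) (m : {set 'I_q} -> nat).

(** The exponent of [x_A] in [epsilon^a], extended by 0 to the empty set. *)
Definition weight A a : nat := \sum_(i in A) a i.

Lemma weightD A a b : weight A (a + b)%MM = weight A a + weight A b.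
Proof. by rewrite /weight -big_split /=; apply: eq_bigr => i _; rewrite mnmDE. Qed.

Lemma weight1 A (i : 'I_q) : weight A U_(i)%MM = (i \in A).
Proof.
rewrite /weight; case: (boolP (i \in A)) => iA; last first.
  rewrite big1 // => j jA; rewrite mnm1E; case: eqP => // e.
  by rewrite e jA in iA.
rewrite (bigD1 i) //= mnm1E eqxx big1 // => j /andP [_ ji].
by rewrite mnm1E eq_sym (negbTE ji).
Qed.

Lemma weight_setC1 (i : 'I_q) a : weight [set~ i] a + a i = mdeg a.
Proof.
rewrite mdegE (bigD1 i) //= addnC /weight; congr (_ + _).
by apply: eq_bigl => j; rewrite !inE.
Qed.

Lemma mdegS_split a r : mdeg a = r.+1 -> exists i b, a = (U_(i) + b)%MM /\ mdeg b = r.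
Proof.
move=> da; have [i ai] : exists i, a i != 0.
  apply/existsP; apply: contraT => /existsPn h.
  by rewrite mdegE big1 // in da => i _; apply/eqP; have := h i; rewrite negbK.
exists i, (a - U_(i))%MM; have e : a = (U_(i) + (a - U_(i)))%MM.
  rewrite addmC submK //; apply/mnm_lepP=> j; rewrite mnm1E.
  by case: eqP => // <-; rewrite lt0n.
by split=> //; have := da; rewrite {1}e mdegD mdeg1 add1n => -[].
Qed.

Definition bounded m r a : bool := (mdeg a == r) && [forall A, weight A a <= m A].

(** The property that makes [m] a label: it is the lcm of the generators dividing it. *)
Definition attained m r : Prop := forall A, exists2 a, bounded m r a & weight A a = m A.

Definition isolated m r v : Prop :=
  exists B, forall b, bounded m r b -> weight B b = m B -> b = v.

Definition redundant m r v : Prop :=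
  bounded m r v /\
  forall A, weight A v = m A ->
    exists2 B, weight B v < m B &
      forall b, bounded m r b -> weight B b = m B -> weight A b = m A.

Definition dichotomy m r : Prop :=
  (forall v, bounded m r v -> isolated m r v) \/ exists v, redundant m r v.

Lemma bounded_weight m r a A : bounded m r a -> weight A a <= m A.
Proof. by case/andP=> _ /forallP. Qed.

(** Dividing by the common factor [epsilon_p] is a bijection between the generators under [m] and
    those under [m'], and lowers weights and bound at [A] by the same amount. *)
Lemma dichotomy_shift r (p : 'I_q) m : (forall m', attained m' r -> dichotomy m' r) ->
  attained m r.+1 -> (forall a, bounded m r.+1 a -> 0 < a p) -> dichotomy m r.+1.
Proof.
move=> IH att pos; pose m' A := m A - (p \in A).
have mp A : (p \in A) <= m A.
  have [a wa <-] := att A; case: (boolP (p \in A)) => // pA.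
  by rewrite /weight (bigD1 p) //= ltn_addr // pos.
have wD A a : weight A (U_(p) + a)%MM = (p \in A) + weight A a by rewrite weightD weight1.
have bD a : bounded m r.+1 (U_(p) + a)%MM = bounded m' r a.
  rewrite /bounded mdegD mdeg1 add1n eqSS; congr (_ && _); apply: eq_forallb => A.
  by rewrite wD /m' leq_subRL // mp.
have split_p b : bounded m r.+1 b -> exists2 a, b = (U_(p) + a)%MM & bounded m' r a.
  move=> wb; have eb : b = (U_(p) + (b - U_(p)))%MM.
    rewrite addmC submK //; apply/mnm_lepP=> j; rewrite mnm1E.
    by case: eqP => // <-; apply: pos.
  by exists (b - U_(p))%MM => //; rewrite -bD -eb.
have eqD A a : (weight A (U_(p) + a)%MM = m A) <-> (weight A a = m' A).
  by rewrite wD /m'; have := mp A; lia.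
case: (IH m').
- move=> A; have [a wa ea] := att A; have [b eb wb] := split_p a wa.
  by exists b => //; apply/eqD; rewrite -eb.
- move=> iso; left=> v wv; have [a ea wa] := split_p v wv.
  have [B hB] := iso a wa; exists B => b wb; have [b' -> wb'] := split_p b wb.
  by move/eqD/(hB _ wb') ->.
- case=> v [wv red]; right; exists (U_(p) + v)%MM; split; first by rewrite bD.
  move=> A /eqD /red [B ltB hB]; exists B.
    by move: ltB; rewrite wD /m'; have := mp B; lia.
  move=> b wb; have [b' -> wb'] := split_p b wb.
  by move/eqD/(hB _ wb')/eqD.
Qed.

Lemma dichotomy_deg1 m : dichotomy m 1.
Proof.
left=> v /andP [/eqP dv /forallP wv].
have [i [b [ev /eqP]]] := mdegS_split dv; rewrite mdeg_eq0 => /eqP eb.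
rewrite {b}eb addm0 in ev; rewrite {v dv}ev in wv *.
exists [set i] => b /andP [/eqP db _] hb.
have [j [c [ec /eqP]]] := mdegS_split db; rewrite mdeg_eq0 => /eqP e0.
rewrite ec e0 addm0 in hb *; move: (wv [set i]) hb.
rewrite !weight1 !inE eqxx.
by case: eqP => [->|] // _; case: (m _).
Qed.

Lemma weight2 A (i j : 'I_q) : weight A (U_(i) + U_(j))%MM = (i \in A) + (j \in A).
Proof. by rewrite weightD !weight1. Qed.

Lemma mdeg2P a : mdeg a = 2 -> exists i j, a = (U_(i) + U_(j))%MM.
Proof.
move=> /mdegS_split [i [b [-> /mdegS_split [j [c [-> /eqP]]]]]].
by rewrite mdeg_eq0 => /eqP->; rewrite addm0; exists i, j.
Qed.

Lemma bounded_deg2 m (i j : 'I_q) :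
  bounded m 2 (U_(i) + U_(j))%MM = [forall A : {set 'I_q}, (i \in A) + (j \in A) <= m A].
Proof.
rewrite /bounded !mdegD !mdeg1 eqxx; apply: eq_forallb => A.
by rewrite weight2.
Qed.

(** Without squares under [m], each generator is isolated by its support. Given a square [ii], some
    [ij] is redundant: [ii] serves every [A] except those containing [j] but not [i]. *)
Lemma dichotomy_deg2 m : (forall i, exists2 a, bounded m 2 a & a i = 0) -> dichotomy m 2.
Proof.
move=> avoid; pose w i j := bounded m 2 (U_(i) + U_(j))%MM.
have wle i j A : w i j -> (i \in A) + (j \in A) <= m A.
  by rewrite /w bounded_deg2 => /forallP/(_ A).
have wC i j : w i j -> w j i by rewrite /w addmC.
have deg b : bounded m 2 b -> mdeg b = 2 by case/andP=> /eqP.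
have full i j b : (forall x, x \in [set i; j] -> ~~ w x x) -> w i j ->
    bounded m 2 b -> weight [set i; j] b = m [set i; j] -> b = (U_(i) + U_(j))%MM.
  move=> nsq wij wb; have [x [y eb]] := mdeg2P (deg b wb).
  rewrite {b}eb weight2 in wb * => hb.
  have [xB yB] : x \in [set i; j] /\ y \in [set i; j].
    by move: (wle i j [set i; j] wij); rewrite -hb !inE !eqxx orbT /=; do 2!case: (_ || _).
  have := nsq x xB; move: xB yB wb; rewrite !inE.
  by case/orP=> /eqP-> /orP [] /eqP->; rewrite -/(w _ _) => wb; rewrite ?wb // addmC.
case: (boolP [exists i, w i i]) => [/existsP [i wi]|/existsPn nsq]; last first.
  left=> v wv; have [i [j ev]] := mdeg2P (deg v wv); rewrite ev in wv *.
  by exists [set i; j] => b; apply: full.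
(* The generator [jk] avoiding [i] is taken to be a square if possible; otherwise no square lives on
   [[set j; k]], and [jk] is alone on its support. *)
right; have [j [k [wa ji ki sq]]] : exists j k, [/\ w j k, j != i, k != i &
    w j j || [forall x in [set j; k], ~~ w x x]].
  case: (boolP [exists j, (j != i) && w j j]) => [/existsP [j /andP [ji wj]]|nsq].
    by exists j, j; rewrite wj.
  have [a wa ai] := avoid i; have [j [k ea]] := mdeg2P (deg a wa).
  rewrite ea in wa; have [ji ki] : j != i /\ k != i.
    by split; apply: contra_eqN ai => /eqP e; rewrite ea mnmDE !mnm1E e eqxx; lia.
  exists j, k; split=> //; apply/orP; right; apply/forall_inP=> x xB.
  apply: contraNN nsq => wx; apply/existsP; exists x; rewrite wx andbT.
  by move: xB; rewrite !inE => /orP [] /eqP->.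
have wij : w i j.
  rewrite /w bounded_deg2; apply/forallP=> A.
  by move: (wle i i A wi) (wle j k A wa); case: (i \in A); case: (j \in A); case: (k \in A); lia.
exists (U_(i) + U_(j))%MM; split=> // A; rewrite weight2 => hA.
case: (boolP ((j \in A) && (i \notin A))) => jA; last first.
  exists [set i].
    by have := wle i i [set i] wi; rewrite weight2 !inE eqxx (negbTE ji); lia.
  move=> b wb; have [x [y eb]] := mdeg2P (deg b wb).
  rewrite {b}eb !weight2 in wb * => hb.
  have [ex ey] : x = i /\ y = i.
    move: hb; have := wle i i [set i] wi; rewrite !inE !eqxx => le2 hb; move: le2; rewrite -hb.
    by case: (eqVneq x i) => [->|_]; case: (eqVneq y i).
  rewrite ex ey; move: hA jA (wle i i A wi); case: (i \in A); case: (j \in A) => //=; lia.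
case: (boolP (w j j)) sq => [wj _|_ /forall_inP nsq].
  by move: jA hA (wle j j A wj); case/andP=> -> /negbTE ->; lia.
exists [set j; k].
  by have := wle j k [set j; k] wa; rewrite weight2 !inE ![i == _]eq_sym (negbTE ji) (negbTE ki) !eqxx orbT.
move=> b wb hb; rewrite (full j k b nsq wa wb hb) weight2.
by move: jA hA (wle j k A wa); case/andP=> -> /negbTE ->; lia.
Qed.

Lemma weight3 A (i j k : 'I_q) : weight A (U_(i) + U_(j) + U_(k))%MM = count3 A i j k.
Proof. by rewrite !weightD !weight1. Qed.

Lemma bounded_deg3 m (i j k : 'I_q) :
  bounded m 3 (U_(i) + U_(j) + U_(k))%MM = bounded3 m i j k.
Proof.
rewrite /bounded !mdegD !mdeg1 eqxx; apply: eq_forallb => A.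
by rewrite weight3.
Qed.

Lemma mdeg3P a : mdeg a = 3 -> exists i j k, a = (U_(i) + U_(j) + U_(k))%MM.
Proof.
move=> /mdegS_split [i [b [-> /mdeg2P [j [k ->]]]]].
by exists i, j, k; rewrite addmA.
Qed.

Lemma dichotomy_deg3 m :
  (forall i, exists2 a, bounded m 3 a & a i = 0) -> dichotomy m 3.
Proof.
move=> avoid; have deg b : bounded m 3 b -> mdeg b = 3 by case/andP=> /eqP.
case: (@dichotomy3 q m) => [i|iso|[i [j [k [wijk red]]]]].
- have [a wa ai] := avoid i; have [x [y [z ea]]] := mdeg3P (deg a wa).
  rewrite ea bounded_deg3 in wa; exists x, y, z; split=> //;
  by apply: contra_eqN ai => /eqP e; rewrite ea !mnmDE !mnm1E e eqxx; lia.
- left=> v wv; have [x [y [z ev]]] := mdeg3P (deg v wv).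
  rewrite {v}ev bounded_deg3 in wv *; have [B hB] := iso _ _ _ wv.
  exists B => b wb; have [x' [y' [z' eb]]] := mdeg3P (deg b wb).
  rewrite {b}eb bounded_deg3 weight3 in wb * => hb.
  by apply/mnmP=> p; rewrite !mnmDE !mnm1E; apply: (hB _ _ _ wb hb (fun t => (t == p) : nat)).
- right; exists (U_(i) + U_(j) + U_(k))%MM; split; first by rewrite bounded_deg3.
  move=> A; rewrite weight3 => /red [B ltB hB]; exists B; first by rewrite weight3.
  move=> b wb; have [x [y [z eb]]] := mdeg3P (deg b wb).
  by rewrite {b}eb bounded_deg3 !weight3 in wb *; apply: hB.
Qed.

(** The bound at the complement of [p] equals the degree exactly when some generator under [m] omits
    [p]. If it differs for some [p], then [epsilon_p] is a common factor and is split off; otherwise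
    the case analysis of the degree applies. *)
Lemma dichotomy_deg_le3 m r : r <= 3 -> attained m r -> dichotomy m r.
Proof.
elim: r m => [|r IH] m.
  move=> _ _; left=> v /andP [+ _]; rewrite mdeg_eq0 => /eqP->.
  by exists set0 => b /andP [+ _] _; rewrite mdeg_eq0 => /eqP.
move=> ler att.
case: (boolP [exists p : 'I_q, m [set~ p] != r.+1]) => [/existsP [p mp]|full].
  apply: (@dichotomy_shift r p) => // [m' att'|a wa]; first by apply: IH => //; apply: ltnW.
  rewrite lt0n; apply: contraNneq mp => ap.
  have deg b : bounded m r.+1 b -> mdeg b = r.+1 by case/andP=> /eqP.
  have [b wb eb] := att [set~ p].
  have lea : r.+1 <= m [set~ p].
    by rewrite -(deg a wa) -(weight_setC1 p a) ap addn0; apply: bounded_weight wa.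
  by rewrite eqn_leq lea andbT -eb -(deg b wb) -(weight_setC1 p b) leq_addr.
have avoid i : exists2 a, bounded m r.+1 a & a i = 0.
  have [a wa ea] := att [set~ i]; exists a => //.
  have := weight_setC1 i a; have /andP [/eqP -> _] := wa.
  move/existsPn: full => /(_ i); rewrite negbK ea => /eqP->; lia.
case: r {IH} ler att full avoid => [|[|[|//]]] _ _ _ avoid.
- exact: dichotomy_deg1.
- exact: dichotomy_deg2.
- exact: dichotomy_deg3.
Qed.

End Weights.

(** * The simplicial boundary *)

Section Boundary.
Local Open Scope ring_scope.
Variables (R : comNzRingType) (V : finType).
Implicit Types (s t : {set V}) (u v : V) (f g : {set V} -> R).

Definition sgn t v : R := (-1) ^+ #|[set w in t | enum_rank w < enum_rank v]%N|.

(** Chains are coefficient functions on all subsets, so the value at [set0] is the augmentation. *)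
Definition boundary f t : R := \sum_(v | v \notin t) sgn t v * f (v |: t).

Lemma sgn_sqr t v : sgn t v * sgn t v = 1.
Proof. by rewrite -expr2 sqrr_sign. Qed.

Lemma sgn_setU1 t u v : u \notin t ->
  sgn (u |: t) v = (-1) ^+ (enum_rank u < enum_rank v)%N * sgn t v.
Proof.
move=> ut; rewrite /sgn -exprD; congr (_ ^+ _).
pose P (w : V) := (enum_rank w < enum_rank v)%N.
change (#|[set w in u |: t | P w]| = (P u + #|[set w in t | P w]|)%N).
have -> : [set w in u |: t | P w] = if P u then u |: [set w in t | P w] else [set w in t | P w].
  apply/setP=> w; case: ifP => Pu; rewrite !inE; case: (eqVneq w u) => [->|] //=.
  by rewrite Pu andbF.
by case: (P u) => //; rewrite cardsU1 inE (negbTE ut).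
Qed.

Lemma sgn_anticomm t u v : u != v -> u \notin t -> v \notin t ->
  sgn t u * sgn (u |: t) v = - (sgn t v * sgn (v |: t) u).
Proof.
move=> uv ut vt; rewrite !sgn_setU1 // !mulrA ![sgn t _ * (-1) ^+ _]mulrC -!mulrA [sgn t v * _]mulrC.
have ruv : enum_rank u != enum_rank v :> nat by apply: contra_neq uv => /val_inj/enum_rank_inj.
by case: ltngtP ruv => // _ _; rewrite expr1 expr0 !mul1r !mulN1r ?opprK.
Qed.

Lemma sgn_swap t u v : u != v -> u \notin t -> v \notin t ->
  sgn (v |: t) u * sgn (u |: t) v = - (sgn t u * sgn t v).
Proof.
move=> uv ut vt; rewrite !sgn_setU1 // mulrACA.
have ruv : enum_rank u != enum_rank v :> nat by apply: contra_neq uv => /val_inj/enum_rank_inj.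
by case: ltngtP ruv => // _ _; rewrite expr1 expr0 ?mul1r ?mulr1 !mulN1r.
Qed.

(* Avoids the division by 2 in [x = - x -> x = 0]: the pairs (u, v) and (v, u) cancel. *)
Lemma sum_antisymmetric (F : V -> V -> R) :
  (forall u, F u u = 0) -> (forall u v, u != v -> F u v = - F v u) -> \sum_u \sum_v F u v = 0.
Proof.
move=> F0 FN; pose lt u v := (enum_rank u < enum_rank v)%N.
have split u : \sum_v F u v = \sum_(v | lt u v) F u v + \sum_(v | lt v u) F u v.
  rewrite (bigID (lt u)) /=; congr (_ + _).
  rewrite (bigID (fun v => v == u)) /= [X in X + _]big1 ?add0r => [|v /andP [_ /eqP->]] //.
  apply: eq_bigl => v; rewrite /lt -leqNgt ltn_neqAle andbC; congr (_ && _).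
  by rewrite (inj_eq val_inj) (inj_eq enum_rank_inj).
rewrite (eq_bigr _ (fun u _ => split u)) big_split /=.
rewrite [X in _ + X](exchange_big_dep predT) //= -big_split big1 //= => u _.
rewrite -big_split big1 //= => v uv; rewrite (FN u v) ?addNr //.
by apply: contraTneq uv => ->; rewrite /lt ltnn.
Qed.

Lemma boundary_boundary f t : boundary (boundary f) t = 0.
Proof.
(* Indexing by ordered pairs of removed vertices, extended by zero, makes the double sum
   antisymmetric. *)
pose F u v := if [&& u \notin t, v \notin t & u != v]
  then sgn t u * sgn (u |: t) v * f (v |: (u |: t)) else 0.
transitivity (\sum_u \sum_v F u v).
  rewrite /boundary big_mkcond; apply: eq_bigr => u _; case: ifP => ut; last first.
    by rewrite big1 // => v _; rewrite /F ut.
  rewrite mulr_sumr big_mkcond; apply: eq_bigr => v _.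
  rewrite /F ut !inE negb_or andbC [v == u]eq_sym /=.
  by case: ifP => // _; rewrite mulrA.
apply: sum_antisymmetric => [u|u v uv]; rewrite /F; first by rewrite eqxx !andbF.
rewrite [v == u]eq_sym uv !andbT [(v \notin t) && _]andbC; case: ifP => [/andP [ut vt]|_].
  by rewrite setUCA (sgn_anticomm uv ut vt) mulNr.
by rewrite oppr0.
Qed.

Lemma boundaryB f g t : boundary (fun s => f s - g s) t = boundary f t - boundary g t.
Proof. by rewrite /boundary -sumrB; apply: eq_bigr => u _; rewrite mulrBr. Qed.

(** The coning operator, with an apex [p t] that may depend on the face, truncated to the faces in
    [P]. *)
Definition homotopy (P : pred {set V}) (p : {set V} -> V) f t : R :=
  if P t && (p t \in t) then sgn (t :\ p t) (p t) * f (t :\ p t) else 0.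

(** The cone identity, boundary of cone plus cone of boundary equals the identity, read where the
    second term vanishes. The hypotheses keep the apex constant on the cofaces involved and make the
    terms dropped by [P] zero. *)
Lemma boundary_homotopy (P : pred {set V}) p f t :
  (forall u, u \notin t -> P (u |: t) -> p (u |: t) = p t) ->
  (p t \notin t -> P (p t |: t)) ->
  (p t \in t -> boundary f (t :\ p t) = 0) ->
  (p t \in t -> forall u, u \notin t -> ~~ P (u |: t) -> f (u |: (t :\ p t)) = 0) ->
  boundary (homotopy P p f) t = f t.
Proof.
move=> pU PU bf0 f0; rewrite /boundary; case: (boolP (p t \in t)) => pt.
  set v := p t in pt pU PU bf0 f0 *; set s := t :\ v in bf0 f0 *.
  have vs : v \notin s by rewrite !inE eqxx.
  have ts : t = v |: s by rewrite setD1K.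
  have outE u : (u \notin s) && (u != v) = (u \notin t).
    by rewrite ts !inE negb_or andbC; case: (eqVneq u v).
  (* Exchanging [u] with the apex costs a sign; the vanishing of [boundary f] at [s] then evaluates
     the sum. *)
  transitivity (- (sgn s v * \sum_(u | u \notin t) sgn s u * f (u |: s))).
    rewrite mulr_sumr -sumrN; apply: eq_bigr => u ut.
    have [us uv] : u \notin s /\ u != v by apply/andP; rewrite outE.
    have vu : v != u by rewrite eq_sym.
    rewrite /homotopy; case: (boolP (P (u |: t))) => Pu; last first.
      by rewrite mulr0 f0 // !mulr0 oppr0.
    rewrite pU // !inE pt orbT /=.
    have -> : (u |: t) :\ v = u |: s.
      by apply/setP=> w; rewrite !inE; case: (eqVneq w v) => [->|] //=; rewrite (negbTE vu).
    rewrite !mulrA {1}ts -mulNr; congr (_ * _).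
    by rewrite sgn_swap // [sgn s v * _]mulrC ?mulNr.
  have := bf0 pt; rewrite /boundary (bigD1 v) //= (eq_bigl _ _ outE) -ts => /eqP.
  rewrite addrC addr_eq0 => /eqP->; rewrite mulrN opprK mulrA sgn_sqr mul1r //.
rewrite (bigD1 (p t)) //= big1 ?addr0 => [|u /andP [ut up]].
  rewrite /homotopy PU // pU ?PU // setU11 /= setU1K //.
  by rewrite mulrA sgn_sqr mul1r.
rewrite /homotopy; case: (boolP (P _)) => //= Pu; last by rewrite mulr0.
by rewrite pU // !inE (negbTE pt) orbF eq_sym (negbTE up) mulr0.
Qed.
End Boundary.

(** * Acyclicity of the Scarf complex in each multidegree *)

Lemma mdeg_le n (a b : 'X_{1..n}) : (a <= b)%MM -> mdeg a <= mdeg b.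
Proof. by move=> ab; rewrite -(submK ab) mdegD leq_addl. Qed.

Section FaceLabel.
Variables (n : nat) (V : finType) (lab : V -> 'X_{1..n}).
Implicit Types (s t : {set V}) (v : V).
Local Notation L := (face_label lab).

Lemma face_label_sub s t : s \subset t -> (L s <= L t)%MM.
Proof.
move=> st; rewrite face_label_le; apply/forall_inP=> v vs.
exact/lab_le_face_label/(subsetP st).
Qed.

Lemma face_labelU1_le m s v : (L (v |: s) <= m)%MM = (lab v <= m)%MM && (L s <= m)%MM.
Proof.
rewrite !face_label_le; apply/forall_inP/andP => [h|[hv /forall_inP hs] w].
  by split; [apply: h; exact: setU11 | apply/forall_inP=> w ws; apply: h; rewrite inE ws orbT].
by rewrite !inE => /orP [/eqP->|/hs].
Qed.

Lemma face_labelE s j : L s j = \max_(v in s) lab v j.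
Proof.
rewrite /face_label (big_morph (fun m : 'X_{1..n} => m j) (id1 := 0) (op1 := maxn)) //.
  move=> a b; rewrite mlcmE mnmDE mnmBE; lia.
by rewrite mnm0E.
Qed.

Lemma face_label1 v : L [set v] = lab v.
Proof. by apply/mnmP=> j; rewrite face_labelE big_set1. Qed.

Lemma scarf_label_inj s t : s \in scarf lab -> L t = L s -> t = s.
Proof.
rewrite inE => /forall_inP hs e; apply/eqP; apply: contraT => /hs.
by rewrite e eqxx.
Qed.

Lemma scarf_label_neq s v : s \in scarf lab -> v \in s -> L (s :\ v) != L s.
Proof.
move=> hs vs; apply/eqP=> /(scarf_label_inj hs) e.
by move: vs; rewrite -e !inE eqxx.
Qed.

(** Toggling [v] then pairs off all faces that share the label of [s]. *)
Definition label_insensitive s v : Prop :=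
  forall t, L t = L s -> L (v |: t) = L s /\ L (t :\ v) = L s.

End FaceLabel.

Section Acyclic.
Local Open Scope ring_scope.
Variables (R : comNzRingType) (n : nat) (V : finType) (lab : V -> 'X_{1..n}).
Implicit Types (s t : {set V}) (u v : V) (f g : {set V} -> R) (M : 'X_{1..n}).
Local Notation L := (face_label lab).
Local Notation D := (scarf lab).

Hypothesis insensitive : forall s, s \notin D -> exists v, label_insensitive lab s v.

Definition under M f : Prop := forall t, ~~ (L t <= M)%MM -> f t = 0.

Lemma under_boundary M f : under M f -> under M (boundary f).
Proof.
move=> uf t tM; apply: big1 => u ut; rewrite uf ?mulr0 //.
by apply: contraNN tM; rewrite face_labelU1_le => /andP [].
Qed.

(** The faces whose label divides [x^M] form a full simplex, a cone with apex [v0]. *)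
Lemma cone_fill M v0 f : (lab v0 <= M)%MM -> under M f -> (forall t, boundary f t = 0) ->
  exists2 g, under M g & forall t, boundary g t = f t.
Proof.
move=> vM uf bf; exists (homotopy predT (fun=> v0) f) => [t tM|t]; last first.
  by apply: boundary_homotopy => // _ u ut.
rewrite /homotopy /=; case: ifP => // vt; rewrite uf ?mulr0 //.
by apply: contraNN tM => h; rewrite -(setD1K vt) face_labelU1_le vM.
Qed.

Lemma notin_scarf s t : s \notin D -> L t = L s -> t \notin D.
Proof. by move=> sD e; apply: contraNN sD => tD; rewrite (scarf_label_inj tD (esym e)). Qed.

(** Each step subtracts a boundary that agrees with [g] on the non-Scarf faces of label degree [d]
    and vanishes on all faces of larger label degree, so [d] can be lowered. *)
Lemma push_down M v0 d g : under M g -> (forall t, t \notin D -> boundary g t = 0) ->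
  (forall t, t \notin D -> (d <= mdeg (L t))%N -> g t = 0) ->
  exists g', [/\ under M g', forall t, t \notin D -> g' t = 0 &
    forall t, boundary g' t = boundary g t].
Proof.
pose freeb s v := [forall t, (L t == L s) ==> (L (v |: t) == L s) && (L (t :\ v) == L s)].
(* The choice depends on the label alone, so faces with the same label share their pairing vertex.
   The default [v0] can occur only for Scarf faces. *)
pose p s := odflt v0 [pick v | freeb s v].
have pE s t : L s = L t -> p s = p t.
  by move=> e; rewrite /p; congr odflt; apply: eq_pick => v; rewrite /freeb e.
have pP s : s \notin D -> label_insensitive lab s (p s).
  move=> /insensitive [v hv]; rewrite /p; case: pickP => [w /forallP hw|no] /=.
    by move=> t e; have := hw t; rewrite e eqxx => /andP [/eqP-> /eqP->].
  have := no v; rewrite /freeb => /negbT /forallPn [t].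
  by rewrite negb_imply => /andP [/eqP /hv [-> ->]]; rewrite !eqxx.
elim: d g => [|d IH] g ug bg gd.
  by exists g; split=> // t tD; apply: gd.
pose P t := (t \notin D) && (mdeg (L t) == d).
pose h := homotopy P p g.
have Dup t u : t \notin D -> u |: t \notin D.
  by apply: contraNN => hD; apply: scarf_closed hD (subsetUr _ _).
have Lup t u : (L t <= L (u |: t))%MM by apply/face_label_sub/subsetUr.
have PL t u : P t -> P (u |: t) -> L (u |: t) = L t.
  by case/andP=> _ /eqP e1 /andP [_ /eqP e2]; apply/esym/mnm_le_deg_eq => //; rewrite e1 e2.
have PE s t : P s -> L t = L s -> P t.
  by case/andP=> sD /eqP e1 e; rewrite /P e e1 eqxx andbT; apply: notin_scarf sD e.
have uh : under M h.
  move=> t tM; rewrite /h /homotopy; case: ifP => // /andP [/andP [tD _] pt].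
  by rewrite ug ?mulr0 //; have [_ ->] := pP t tD t erefl.
have bh t : P t -> boundary h t = g t.
  move=> Pt; have tD : t \notin D by case/andP: Pt.
  apply: boundary_homotopy => [u ut Pu|pt|pt|pt u ut Pu].
  - exact/pE/PL.
  - by apply: PE Pt _; have [] := pP t tD t erefl.
  - by apply: bg; apply: (notin_scarf tD); have [] := pP t tD t erefl.
  have [_ Ls] := pP t tD t erefl; set s := t :\ p t in Ls *.
  have sD : s \notin D by exact: (notin_scarf tD Ls).
  (* The label of [u |: s] has degree above [d]: in degree [d] it would equal [L t] and put [u |: t]
     in [P]. *)
  apply: gd; first exact: Dup.
  have le1 : (d <= mdeg (L (u |: s)))%N.
    by case/andP: Pt => _ /eqP <-; rewrite -Ls; apply: mdeg_le.
  rewrite ltn_neqAle le1 andbT; apply: contraNN Pu => /eqP e.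
  have Lus : L (u |: s) = L t.
    apply/esym/mnm_le_deg_eq; first by rewrite -Ls.
    by rewrite -e; case/andP: Pt => _ /eqP.
  apply: (PE t) => //; apply: mnm_le_anti => //.
  rewrite face_labelU1_le lepm_refl andbT -Lus.
  by apply: lab_le_face_label; exact: setU11.
pose g1 t := g t - boundary h t.
have bg1 t : boundary g1 t = boundary g t by rewrite boundaryB boundary_boundary subr0.
have [||t tD dt|g' [ug' Dg' bg']] := IH g1.
- by move=> t tM; rewrite /g1 ug // (under_boundary uh) // subr0.
- by move=> t tD; rewrite bg1 bg.
- case: (boolP (P t)) => [Pt|nPt]; first by rewrite /g1 bh // subrr.
  have ltd : (d < mdeg (L t))%N.
    by rewrite ltn_neqAle dt andbT eq_sym; apply: contraNN nPt; rewrite /P tD.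
  rewrite /g1 gd // sub0r /boundary big1 ?oppr0 // => u ut.
  rewrite /h /homotopy /P (_ : _ == d = false) ?andbF ?mulr0 //.
  by apply: gtn_eqF; apply: leq_trans ltd _; apply: mdeg_le.
- by exists g'; split=> // t; rewrite bg' bg1.
Qed.

Lemma scarf_acyclic M v0 f : (lab v0 <= M)%MM -> under M f -> (forall t, t \notin D -> f t = 0) ->
  (forall t, boundary f t = 0) ->
  exists g, [/\ under M g, forall t, t \notin D -> g t = 0 & forall t, boundary g t = f t].
Proof.
move=> vM uf fD bf; have [g ug bg] := cone_fill vM uf bf.
(* Labels dividing [x^M] have degree at most [mdeg M], so the starting condition holds trivially. *)
have [||g' [ug' Dg' bg']] := push_down v0 (d := (mdeg M).+1) ug.
- by move=> t tD; rewrite bg fD.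
- move=> t _ lt; apply: ug; apply: contraTN lt => /mdeg_le.
  by rewrite -ltnNge.
- by exists g'; split=> // t; rewrite bg' bg.
Qed.

End Acyclic.

(** * Homogenized chains *)

Section Homogenization.
Local Open Scope ring_scope.
Variables (k : fieldType) (n : nat) (V : finType) (lab : V -> 'X_{1..n}).
Local Notation S := {mpoly k[n]}.
Local Notation L := (face_label lab).
Local Notation D := (scarf lab).
Local Notation chain := (chain k n D).
Implicit Types (s t : {set V}) (u v : V) (m M : 'X_{1..n}).

(* Multiplying the coefficient of a face by its label turns the homogenized
   differential and the augmentation into the plain simplicial boundary. *)
Definition lift i (c : chain i) s : S :=
  oapp (fun s' : face D i => c s' * 'X_[L s]) 0 (insub s).

Definition to_face i s (h : (s \in D) && (#|s| == i.+1)) : face D i := exist _ s h.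

Lemma lift_face i (c : chain i) (s : face D i) : lift c (val s) = c s * 'X_[L (val s)].
Proof. by rewrite /lift valK. Qed.

Lemma lift_out i (c : chain i) s : ~~ ((s \in D) && (#|s| == i.+1)) -> lift c s = 0.
Proof. by move=> h; rewrite /lift insubN. Qed.

Lemma mulXI m : injective (fun p : S => p * 'X_[m]).
Proof. by move=> p q /= e; apply/mpolyP=> l; rewrite -(mcoeffMX p m l) e mcoeffMX. Qed.

Lemma lift_inj i (c d : chain i) : lift c =1 lift d -> c = d.
Proof. by move=> e; apply/ffunP=> s; apply: (@mulXI (L (val s))); rewrite -!lift_face. Qed.

Lemma face_signE s v : v \notin s -> face_sign k n (v |: s) v = sgn S s v.
Proof.
move=> vs; rewrite /face_sign /sgn; congr (_ ^+ _); apply: eq_card => w.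
by rewrite !inE; case: (eqVneq w v) => //= ->; rewrite ltnn andbF.
Qed.


(** Removing [v] from [s] to get [t] amounts to adding [v] to [t]. The parameter [F] covers both the
    differential and the augmentation. *)
Lemma sum_faces i (F : {set V} -> V -> S) (c : chain i) t :
  (forall s v, v \notin t -> s = v |: t -> F s v = sgn S t v * 'X_[L s]) ->
  \sum_(s : face D i) \sum_(v in val s | val s :\ v == t) c s * F (val s) v =
  boundary (lift c) t.
Proof.
move=> FE; rewrite (exchange_big_dep predT) //= /boundary [RHS]big_mkcond.
apply: eq_bigr => v _.
have cond s : (v \in s) && (s :\ v == t) = (v \notin t) && (s == v |: t).
  apply/andP/andP => [[vs /eqP <-]|[vt /eqP ->]]; first by rewrite !inE eqxx setD1K.
  by rewrite setU11 setU1K.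
rewrite (eq_bigl _ _ (fun s : face D i => cond (val s))); case: ifP => vt /=; last first.
  by rewrite big_pred0.
case: (boolP ((v |: t \in D) && (#|v |: t| == i.+1))) => h; last first.
  rewrite lift_out // mulr0 big_pred0 // => s; apply: contraNF h => /eqP <-.
  exact: (valP s).
rewrite (big_pred1 (to_face h)) => [|s]; last by rewrite -val_eqE.
by rewrite (FE _ _ vt erefl) -/(val (to_face h)) (lift_face c (to_face h)) /= mulrCA.
Qed.

Lemma lift_differential i (c : chain i.+1) t : lift (differential lab c) t = boundary (lift c) t.
Proof.
case: (boolP ((t \in D) && (#|t| == i.+1))) => ht; last first.
  rewrite lift_out // /boundary big1 // => v vt; rewrite lift_out ?mulr0 //.
  apply: contraNN ht => /andP [hD]; rewrite cardsU1 vt add1n eqSS => ->.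
  by rewrite (scarf_closed hD) ?subsetUr.
rewrite (lift_face (differential lab c) (to_face ht)) ffunE /= mulr_suml.
pose F s v := face_sign k n s v * 'X_[L s - L (s :\ v)] * 'X_[L (s :\ v)].
rewrite -(@sum_faces _ F) => [|s v vt ->]; last first.
  rewrite /F -mulrA -mpolyXD setU1K // submK ?face_signE //.
  by apply/face_label_sub/subsetUr.
apply: eq_bigr => s _; rewrite mulr_suml; apply: eq_bigr => v /andP [_ /eqP e].
by rewrite /F -!mulrA e.
Qed.

Lemma augmentationE (c : chain 0) : augmentation lab c = boundary (lift c) set0.
Proof.
rewrite -(@sum_faces _ (fun s _ => 'X_[L s])) => [|s v _ _]; last first.
  rewrite /sgn (_ : [set w in set0 | _] = set0) ?cards0 ?mul1r //.
  by apply/setP=> w; rewrite !inE.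
apply: eq_bigr => s _; have /andP [_ /cards1P [v ev]] := valP s.
rewrite (big_pred1 v) // => w; rewrite ev !inE /=.
by case: (eqVneq w v) => //= ->; rewrite setDv eqxx.
Qed.

Lemma boundary_lift0 (c : chain 0) t : t != set0 -> boundary (lift c) t = 0.
Proof.
move=> t0; apply: big1 => v vt; rewrite lift_out ?mulr0 //.
by rewrite cardsU1 vt add1n eqSS cards_eq0 (negbTE t0) andbF.
Qed.

Lemma mcoeff_mulX_out (p : S) m M : ~~ (m <= M)%MM -> (p * 'X_[m])@_M = 0.
Proof.
move=> mM; apply/eqP; rewrite mcoeff_eq0; apply: contraNN mM => /msuppM_le.
case/allpairsP=> [[u v] /= [_]]; rewrite msuppX inE => /eqP -> ->.
exact: lem_addl.
Qed.

Lemma mcoeff_boundary (F : {set V} -> S) t M :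
  (boundary F t)@_M = boundary (fun s => (F s)@_M) t.
Proof.
by rewrite /boundary raddf_sum; apply: eq_bigr => v _; rewrite /= raddfMsign.
Qed.

Hypothesis insensitive : forall s, s \notin D -> exists v, label_insensitive lab s v.

(** The coefficients of [x^M] in [lift c] form a simplicial cycle over [k], supported on Scarf faces
    whose label divides [x^M]. *)
Lemma multidegree_fill i (c : chain i) M : (forall t, boundary (lift c) t = 0) ->
  exists g : {set V} -> k, [/\ under lab M g,
    forall t, ~~ ((t \in D) && (#|t| == i.+2)) -> g t = 0 &
    forall t, boundary g t = (lift c t)@_M].
Proof.
move=> bc; pose f t := (lift c t)@_M.
have uf : under lab M f.
  move=> t tM; rewrite /f; case: (boolP ((t \in D) && (#|t| == i.+1))) => ht.
    by rewrite (lift_face c (to_face ht)) mcoeff_mulX_out.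
  by rewrite lift_out // mcoeff0.
case: (boolP [exists v, (lab v <= M)%MM]) => [/existsP [v0 vM]|/existsPn noV]; last first.
  exists (fun=> 0); split=> // t; rewrite /boundary big1 => [|v _]; last by rewrite mulr0.
  have [/uf//|/negPn tM] := boolP (~~ (L t <= M)%MM).
  rewrite lift_out ?mcoeff0 //; apply: contraTN tM => /andP [_ /eqP ct].
  have /card_gt0P [v vt] : (0 < #|t|)%N by rewrite ct.
  by apply: contra (noV v); apply: lepm_trans (lab_le_face_label _ vt).
have [||g [ug Dg bg]] := scarf_acyclic insensitive vM uf.
- by move=> t tD; rewrite /f lift_out ?mcoeff0 // (negbTE tD).
- by move=> t; rewrite -mcoeff_boundary bc mcoeff0.
(* The filling may have components in other dimensions; only the one bounding [i]-faces is kept. *)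
exists (fun t => if #|t| == i.+2 then g t else 0); split=> [t tM|t|t].
- by case: ifP => // _; apply: ug.
- by case: ifP => [_|//]; rewrite andbT; apply: Dg.
have bE : boundary (fun s : {set V} => if #|s| == i.+2 then g s else 0) t =
    if #|t| == i.+1 then boundary g t else 0.
  rewrite /boundary; case: ifP => ct.
    by apply: eq_bigr => v vt; rewrite cardsU1 vt add1n eqSS ct.
  by rewrite big1 // => v vt; rewrite cardsU1 vt add1n eqSS ct mulr0.
rewrite bE; case: ifP => ct; first exact: bg.
by rewrite lift_out ?mcoeff0 // ct andbF.
Qed.

(** Finitely many multidegrees occur in [lift c]; each is filled separately and the fillings are
    reassembled. *)
Lemma chain_fill i (c : chain i) : (forall t, boundary (lift c) t = 0) ->
  exists b : chain i.+1, differential lab b = c.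
Proof.
move=> bc; pose Ms := undup (flatten [seq msupp (lift c t) | t : {set V}]).
have MsP t M : M \notin Ms -> (lift c t)@_M = 0.
  move=> h; apply/eqP; rewrite mcoeff_eq0; apply: contraNN h => h.
  rewrite mem_undup; apply/flattenP; exists (msupp (lift c t)) => //.
  by apply/mapP; exists t; rewrite ?mem_enum.
have [g hg] := @fin_all_exists (seq_sub Ms) (fun=> {set V} -> k) _
  (fun N => multidegree_fill (ssval N) bc).
(* The truncated subtraction of exponents is harmless: [g N] vanishes unless the label of [s]
   divides [x^N]. *)
pose b : chain i.+1 := [ffun s : face D i.+1 =>
  \sum_(N : seq_sub Ms) g N (val s) *: 'X_[ssval N - L (val s)]].
have lb t : lift b t = \sum_(N : seq_sub Ms) g N t *: 'X_[ssval N].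
  case: (boolP ((t \in D) && (#|t| == i.+2))) => ht; last first.
    by rewrite lift_out // big1 // => M _; have [_ -> //] := hg M; rewrite scale0r.
  rewrite (lift_face b (to_face ht)) ffunE mulr_suml /=; apply: eq_bigr => M _.
  have [tM|tM] := boolP (L t <= ssval M)%MM; first by rewrite -scalerAl -mpolyXD submK.
  by have [ug _ _] := hg M; rewrite ug // !scale0r mul0r.
exists b; apply: lift_inj => t; rewrite lift_differential.
apply/mpolyP=> M; rewrite mcoeff_boundary.
have lbM s : (lift b s)@_M = \sum_(N : seq_sub Ms) g N s * (ssval N == M)%:R.
  by rewrite lb raddf_sum; apply: eq_bigr => N _; rewrite /= mcoeffZ mcoeffX.
case: (boolP (M \in Ms)) => hM; last first.
  rewrite MsP // /boundary big1 // => v _; rewrite lbM big1 ?mulr0 // => N _.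
  by case: eqP => [e|_]; rewrite ?mulr0 //; rewrite -e (valP N) in hM.
have [_ _ <-] := hg (SeqSub hM); apply: eq_bigr => v _; congr (_ * _).
rewrite lbM (bigD1 (SeqSub hM)) //= eqxx mulr1 big1 ?addr0 // => N neq.
by case: eqP => [e|_]; rewrite ?mulr0 //; case/negP: neq; apply/eqP/val_inj.
Qed.

End Homogenization.

(** * Scarf resolutions of extremal powers *)

Section IdealSpan.
Local Open Scope ring_scope.
Variables (R : comNzRingType) (P : R -> Prop).

Lemma ideal_span0 : ideal_span P 0.
Proof. by exists [::] => //; rewrite big_nil. Qed.

Lemma ideal_spanD p q : ideal_span P p -> ideal_span P q -> ideal_span P (p + q).
Proof.
case=> s hs -> [s' hs' ->]; exists (s ++ s'); last by rewrite big_cat.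
by move=> x; rewrite mem_cat => /orP [/hs|/hs'].
Qed.

Lemma ideal_span_sum (J : Type) (r : seq J) (Q : pred J) (F : J -> R) :
  (forall j, Q j -> ideal_span P (F j)) -> ideal_span P (\sum_(j <- r | Q j) F j).
Proof. exact/(big_ind (ideal_span P) ideal_span0 ideal_spanD). Qed.

End IdealSpan.

(** * A criterion for the Scarf complex to support a minimal resolution *)

Section ScarfResolution.
Local Open Scope ring_scope.
Variables (k : fieldType) (n : nat) (V : finType) (lab : V -> 'X_{1..n}).
Local Notation S := {mpoly k[n]}.
Local Notation D := (scarf lab).

Lemma irrelevant_idealX m : m != 0%MM -> irrelevant_ideal ('X_[m] : S).
Proof.
move=> m0; have [|j [m' [-> _]]] := @mdegS_split n m (mdeg m).-1.
  by rewrite prednK // lt0n mdeg_eq0.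
by rewrite mpolyXD mulrC; apply/ideal_spanM/ideal_span_in; exists j.
Qed.

(** A Scarf face never shares its label with a facet, so the monomial coefficients are not 1. *)
Lemma scarf_differential_minimal i (c : chain k n D i.+1) (t : face D i) :
  irrelevant_ideal (differential lab c t).
Proof.
rewrite ffunE; apply: ideal_span_sum => s _; apply: ideal_span_sum => v /andP [vs _].
apply/ideal_spanM/ideal_spanM/irrelevant_idealX.
have /andP [sD _] := valP s; apply: contra (scarf_label_neq sD vs) => /eqP e.
apply/eqP/mnm_le_anti; first exact/face_label_sub/subsetDl.
by apply/mnm_lepP=> j; move/mnmP/(_ j): e; rewrite mnmBE mnm0E => /eqP; rewrite subn_eq0.
Qed.

Theorem scarf_resolution (I : S -> Prop) :
  (forall s, s \notin D -> exists v, label_insensitive lab s v) ->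
  (forall v, [set v] \in D) ->
  (forall p, I p <-> exists a : V -> S, p = \sum_v a v * 'X_[lab v]) ->
  supports_minimal_free_resolution lab D I.
Proof.
move=> insensitive vD IE; split; last exact: scarf_differential_minimal.
have bb i (b : chain k n D i.+1) t : boundary (lift (differential lab b)) t = 0.
  rewrite -(boundary_boundary (lift b) t); apply: eq_bigr => v _.
  by rewrite lift_differential.
have vface v : ([set v] \in D) && (#|[set v]| == 1) by rewrite vD cards1.
split=> [p|c|i c].
- have augE c : augmentation lab c = \sum_v c (to_face (vface v)) * 'X_[lab v].
    rewrite augmentationE /boundary (eq_bigl predT) => [|v]; last by rewrite inE.
    apply: eq_bigr => v _; rewrite setU0 (lift_face c (to_face (vface v))) /=.
    rewrite face_label1 /sgn (_ : [set w in set0 | _] = set0) ?cards0 ?mul1r //.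
    by apply/setP=> w; rewrite !inE.
  rewrite IE; split=> [[a ->]|[c <-]]; last by exists (fun v => c (to_face (vface v))).
  (* On a one-vertex face the sum is just [a] at that vertex. *)
  exists [ffun s : face D 0 => \sum_(v in val s) a v]; rewrite augE.
  by apply: eq_bigr => v _; rewrite ffunE big_set1.
- split=> [c0|[b <-]]; last by rewrite augmentationE bb.
  apply: chain_fill => // t; case: (eqVneq t set0) => [->|]; last exact: boundary_lift0.
  by rewrite -augmentationE.
- split=> [c0|[b <-]].
    apply: chain_fill => // t; rewrite -lift_differential c0 /lift.
    by case: insub => //= s; rewrite ffunE mul0r.
  by apply: lift_inj => t; rewrite lift_differential bb /lift; case: insub => //= s; rewrite ffunE mul0r.
Qed.

End ScarfResolution.

(** * Labels of extremal powers as maximal weights *)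

Section ExtremalIdeals.
Variables (q r : nat).
Implicit Types (s t : {set exponents q r}) (v w : exponents q r).
Local Notation lab := (@extremal_label q r).
Local Notation L := (face_label lab).
Local Notation vec v := (val (val v)).

Lemma extremal_labelE v (A : nonempty_subset q) : lab v (enum_rank A) = weight (val A) (vec v).
Proof.
rewrite /extremal_label /epsilon_pow mnm_sumE /weight [RHS]big_mkcond; apply: eq_bigr => i _.
by rewrite mulmnE epsilonE; case: (i \in val A); rewrite ?mul1n ?mul0n.
Qed.

Definition max_weight s (A : {set 'I_q}) : nat := \max_(v in s) weight A (vec v).

Lemma face_label_max_weight s t : (L t = L s) <-> (max_weight t =1 max_weight s).
Proof.
split=> e.
  move=> A; case: (eqVneq A set0) => [->|A0].
    by rewrite /max_weight !big1 // => v _; rewrite /weight big_set0.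
  move/mnmP/(_ (enum_rank (exist _ A A0 : nonempty_subset q))): e.
  rewrite !face_labelE /max_weight => e.
  by rewrite -(eq_bigr _ (fun v _ => extremal_labelE v (exist _ A A0))) e;
    apply: eq_bigr => v _; rewrite extremal_labelE.
apply/mnmP=> j; rewrite !face_labelE -(enum_valK j).
have := e (val (enum_val j)); rewrite /max_weight => e'.
by rewrite (eq_bigr _ (fun v _ => extremal_labelE v _)) e';
  apply: eq_bigr => v _; rewrite extremal_labelE.
Qed.

Hypothesis r_gt0 : 0 < r.

Lemma face_label_neq0 s : s != set0 -> L s != 0%MM.
Proof.
case/set0Pn=> v vs; apply/eqP=> e.
have := eqP (valP v); have := lab_le_face_label lab vs; rewrite e => le0 dv.
have : (vec v <= 0)%MM.
  apply: epsilon_pow_le; apply: lepm_trans le0 _; apply/mnm_lepP=> j.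
  by rewrite mnm0E.
move=> /mdeg_le; rewrite mdeg0 dv; lia.
Qed.

Lemma weight_le_max s v A : v \in s -> weight A (vec v) <= max_weight s A.
Proof. by move=> vs; apply: (@leq_bigmax_cond _ _ (fun v => weight A (vec v))). Qed.

Lemma max_weight_attained s A : s != set0 -> exists2 v, v \in s & weight A (vec v) = max_weight s A.
Proof.
case/set0Pn=> v vs; have [|w ws e] := @eq_bigmax_cond _ (mem s) (fun v => weight A (vec v)).
  by apply/card_gt0P; exists v.
by exists w.
Qed.

Lemma bounded_face s v : v \in s -> bounded (max_weight s) r (vec v).
Proof. by move=> vs; apply/andP; split; [exact: (valP v) | apply/forallP=> A; exact: weight_le_max]. Qed.

Lemma exponentsP a : mdeg a = r -> exists v : exponents q r, vec v = a.
Proof.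
move=> da; have ha : (mdeg a < r.+1) by rewrite da.
have ha' : mdeg (BMultinom ha) == r by apply/eqP.
by exists (exist _ (BMultinom ha) ha').
Qed.

Lemma vec_inj v w : vec v = vec w -> v = w.
Proof. by move=> e; do 2!apply: val_inj. Qed.

Lemma same_label_neq0 s t : s != set0 -> L t = L s -> t != set0.
Proof.
move=> s0 e; apply: contraNneq (face_label_neq0 s0) => t0.
by rewrite -e t0 /face_label big_set0.
Qed.

(** Adding [v] raises no maximum, since [v] divides the label. Removing [v] loses none: if [v]
    attains the maximum at [A], so does any vertex attaining it at [B], and that vertex is not [v],
    which falls short at [B]. *)
Lemma redundant_insensitive s v : s != set0 ->
  redundant (max_weight s) r (vec v) -> label_insensitive lab s v.
Proof.
move=> s0 [wv red] t e; have t0 := same_label_neq0 s0 e.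
move/face_label_max_weight: e => e; split; apply/face_label_max_weight=> A.
  rewrite -e; apply/eqP; rewrite eqn_leq; apply/andP; split.
    apply/bigmax_leqP=> w; rewrite !inE => /orP [/eqP->|]; last exact: weight_le_max.
    by rewrite e; apply: bounded_weight wv.
  by apply/bigmax_leqP=> w wt; apply: weight_le_max; rewrite inE wt orbT.
rewrite -e; apply/eqP; rewrite eqn_leq; apply/andP; split.
  by apply/bigmax_leqP=> w; rewrite !inE => /andP [_]; apply: weight_le_max.
have [w wt ew] := max_weight_attained A t0; case: (eqVneq w v) => [ewv|wv'].
  have [B ltB hB] : exists2 B, weight B (vec v) < max_weight s B &
      forall b, bounded (max_weight s) r b -> weight B b = max_weight s B ->
        weight A b = max_weight s A by apply: red; rewrite -ewv ew.
  have [w' w't ew'] := max_weight_attained B t0.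
  have neq : w' != v by apply: contraTneq ltB => ev; rewrite -e -ew' ev ltnn.
  have wb : bounded (max_weight s) r (vec w').
    by move: (bounded_face w't); rewrite /bounded (eq_forallb (fun A => congr1 (leq _) (e A))).
  by rewrite e -(hB _ wb) ?ew' //; apply: weight_le_max; rewrite !inE neq.
by rewrite -ew; apply: weight_le_max; rewrite !inE wv'.
Qed.

(** Every face with this label meets every [W_B], hence contains each generator that is alone in
    some [W_B]. So all such faces consist of the same generators. *)
Lemma isolated_scarf s : s != set0 ->
  (forall a, bounded (max_weight s) r a -> isolated (max_weight s) r a) -> s \in scarf lab.
Proof.
move=> s0 iso; rewrite inE; apply/forall_inP=> t ts; apply: contraNneq ts => eL.
have t0 := same_label_neq0 s0 eL; move/face_label_max_weight: eL => e.
have bt v : v \in t -> bounded (max_weight s) r (vec v).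
  by move=> vt; move: (bounded_face vt); rewrite /bounded (eq_forallb (fun A => congr1 (leq _) (e A))).
apply/eqP/setP=> v; apply/idP/idP=> vin.
  have [B hB] := iso _ (bt v vin); have [w ws ew] := max_weight_attained B s0.
  by rewrite -(vec_inj (hB _ (bounded_face ws) ew)).
have [B hB] := iso _ (bounded_face vin); have [w wt ew] := max_weight_attained B t0.
by rewrite e in ew; rewrite -(vec_inj (hB _ (bt _ wt) ew)).
Qed.

Lemma set0_scarf : set0 \in scarf lab.
Proof.
rewrite inE; apply/forall_inP=> t t0; apply: contraNneq (face_label_neq0 t0) => ->.
by rewrite /face_label big_set0.
Qed.

Lemma extremal_insensitive s : r <= 3 -> s \notin scarf lab -> exists v, label_insensitive lab s v.
Proof.
move=> r3 sD; have s0 : s != set0 by apply: contraNneq sD => ->; apply: set0_scarf.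
have att : attained (max_weight s) r.
  by move=> A; have [v vs ev] := max_weight_attained A s0; exists (vec v); first exact: bounded_face.
case: (dichotomy_deg_le3 r3 att) => [iso|[a [wa red]]].
  by case/negP: sD; apply: isolated_scarf.
have [v ev] : exists v, vec v = a by apply: exponentsP; case/andP: wa => /eqP.
by exists v; apply: redundant_insensitive => //; rewrite ev.
Qed.

(** Vertices of a face labeled like [v] divide that label, and generators of equal degree dividing
    one another coincide. *)
Lemma vertex_scarf v : [set v] \in scarf lab.
Proof.
rewrite inE; apply/forall_inP=> t tv; apply: contraNneq tv => eL.
have t0 : t != set0.
  by apply: (same_label_neq0 _ eL); apply/set0Pn; exists v; rewrite set11.
have sub w : w \in t -> w = v.
  move=> wt; apply: vec_inj; apply: mnm_le_deg_eq.
    apply: epsilon_pow_le; have := lab_le_face_label lab wt.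
    by rewrite eL face_label1.
  by rewrite (eqP (valP w)) (eqP (valP v)).
rewrite eqEsubset; apply/andP; split; first by apply/subsetP=> w /sub ->; rewrite set11.
have [w wt] := set0Pn _ t0; by rewrite sub1set -(sub w wt).
Qed.

Lemma extremal_pow_span (k : fieldType) (p : {mpoly k[nvars q]}) :
  ideal_pow (@extremal_ideal k q) r p <->
  exists a : exponents q r -> {mpoly k[nvars q]}, p = (\sum_v a v * 'X_[lab v])%R.
Proof.
split=> [Ip|[a ->]]; last first.
  case: r r_gt0 a => // r' _ a; apply: ideal_span_sum => v _; apply: ideal_spanM.
  exact: (extremal_pow_mem k (eqP (valP v))).
pose J p := exists a : exponents q r -> {mpoly k[nvars q]}, p = (\sum_v a v * 'X_[lab v])%R.
rewrite -/(J p) (mpolyE p) big_seq; apply: (big_ind J).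
- by exists (fun=> 0%R); rewrite big1 // => v _; rewrite mul0r.
- move=> _ _ [a ->] [b ->]; exists (fun v => (a v + b v)%R).
  by rewrite -big_split; apply: eq_bigr => v _; rewrite mulrDl.
(* Each monomial of [p] is a multiple of some generator, so [p] is treated term by term. *)
move=> m /(extremal_pow_msupp Ip) [b db bm]; have [v ev] := exponentsP db.
exists (fun w => if w == v then (p@_m *: 'X_[m - lab v])%R else 0%R).
rewrite (bigD1 v) //= eqxx big1 ?addr0 => [|w /negbTE ->]; last by rewrite mul0r.
by rewrite -scalerAl -mpolyXD submK // /extremal_label ev.
Qed.

End ExtremalIdeals.

Theorem theorem1p4 (k : fieldType) (q : nat) (q_ge1 : (1 <= q)%N) :
  supports_minimal_free_resolution (@extremal_label q 3) (extremal_scarf q 3)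
    (ideal_pow (@extremal_ideal k q) 3).
Proof.
apply: scarf_resolution => [s|v|p].
- exact: extremal_insensitive.
- exact: vertex_scarf.
- exact: extremal_pow_span.
Qed.
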